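(* Let $A$ be a real $m\times n$ matrix with full column rank ($m\ge n$), let $b\in\mathbb{R}^m$, let $x_*\in\mathbb{R}^n$ be the solution of the minimization problem $\min_x\|Ax-b\|_2^2$, and let $e:=Ax_*-b$. Assume that $s\le\alpha n$ for some constant $\alpha<1$. For any initial estimate $x_0\in\mathbb{R}^n$, the block Gaussian Kaczmarz method with block size $s$ produces a sequence of iterates $\{x_k,\ k\ge 0\}$ that satisfies $$\mathbb{E}\|x_k-x_*\|_2^2\le\left(1-\frac{1}{80}\left[\frac{\sqrt s\,\sigma_{\min}(A)}{\sqrt s\,\|A\|+\|A\|_F}\right]^2\right)^k\|x_0-x_*\|_2^2+\frac{C\,(\sqrt s\,\|A\|+\|A\|_F)^2\,\|e\|_2^2}{\sigma_{\min}^4(A)\,(\sqrt n-\sqrt s)^2},$$ where $C>0$ is an absolute constant.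
   Context: $\sigma_{\min}(A)$ denotes the smallest singular value of $A$, $\|A\|=\sup_{\|x\|_2=1}\|Ax\|_2$ is the operator norm, $\|A\|_F=\sqrt{\mathrm{trace}(A^TA)}$ is the Frobenius norm. $M^\dagger$ denotes the Moore-Penrose inverse of a matrix $M$. Block Gaussian Kaczmarz (BGK) method with block size $s$ (a positive integer): starting from $x_0\in\mathbb{R}^n$, at each iteration a new $m\times s$ random matrix $S$ with i.i.d. standard normal entries is drawn, independently of all matrices drawn at previous iterations, and $$x_{k+1}=\bigl(\mathrm{Id}-(S^TA)^\dagger S^TA\bigr)x_k+(S^TA)^\dagger S^Tb .$$ The expectation $\mathbb{E}$ is over all the random matrices drawn.
   Formalization: The formal theorem additionally assumes that s ≤ n−2 or Ax_* = b; for s = n−1 and e ≠ 0 (e.g. n = 2, s = 1, α = 1/2, m = 3) the expectation is infinite for every k ≥ 1, so the stated bound fails there. *)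

(* Defs.v *)
From HB Require Import structures.
From mathcomp Require Import all_boot all_order all_algebra.
From mathcomp Require Import all_classical all_reals all_analysis.

Set Implicit Arguments.
Unset Strict Implicit.
Unset Printing Implicit Defensive.

Import Order.TTheory GRing.Theory Num.Theory.
Import numFieldNormedType.Exports.

Local Open Scope classical_set_scope.
Local Open Scope ring_scope.

(* The Euclidean norm: `|x| on matrices is the sup norm in MathComp-Analysis. *)
Definition norm2 (R : realType) (n : nat) (x : 'cV[R]_n) : R :=
  Num.sqrt (\sum_(i < n) x i ord0 ^+ 2).

Definition op_norm (R : realType) (m n : nat) (A : 'M[R]_(m, n)) : R :=
  sup [set norm2 (A *m x) | x in [set x : 'cV[R]_n | norm2 x = 1]].

Definition frobenius (R : realType) (m n : nat) (A : 'M[R]_(m, n)) : R :=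
  Num.sqrt (\tr (A^T *m A)).

(* Square roots of the eigenvalues of A^T A, which are all real: the n singular
   values of A when n <= m (for m < n this adds n - m zero values). *)
Definition singular_values (R : realType) (m n : nat) (A : 'M[R]_(m, n)) :
    set R :=
  [set Num.sqrt a | a in [set a | eigenvalue (A^T *m A) a]].

(* The inf is a minimum: for 0 < n the set is finite and nonempty. *)
Definition sigma_min (R : realType) (m n : nat) (A : 'M[R]_(m, n)) : R :=
  inf (singular_values A).

Definition is_least_squares (R : realType) (m n : nat) (A : 'M[R]_(m, n))
    (b : 'cV[R]_m) (xs : 'cV[R]_n) : Prop :=
  forall x : 'cV[R]_n, norm2 (A *m xs - b) ^+ 2 <= norm2 (A *m x - b) ^+ 2.

(* The four Penrose conditions. *)
Definition is_pseudo_inverse (R : realType) (m n : nat) (M : 'M[R]_(m, n))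
    (X : 'M[R]_(n, m)) : Prop :=
  [/\ M *m X *m M = M, X *m M *m X = X,
      (M *m X)^T = M *m X & (X *m M)^T = X *m M].

(* Not to be confused with MathComp's pinvmx, a partial inverse that need not
   satisfy the symmetry conditions. *)
Definition moore_penrose (R : realType) (m n : nat) (M : 'M[R]_(m, n)) :
    'M[R]_(n, m) :=
  xget 0 [set X | is_pseudo_inverse M X].

Lemma row_free_gram (R : realType) (m n : nat) (M : 'M[R]_(m, n)) :
  row_free M -> M *m M^T \in unitmx.
Proof.
move=> freeM; rewrite -row_free_unit -kermx_eq0; apply/rowV0P => u /sub_kermxP.
move=> uM0; apply: (row_free_inj freeM); rewrite mul0mx.
have : (u *m M) *m (u *m M)^T = 0.
  by rewrite trmx_mul mulmxA -(mulmxA u) uM0 mul0mx.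
set v := u *m M => /matrixP/(_ ord0 ord0); rewrite !mxE => /eqP.
under eq_bigr do rewrite [_^T _ _]mxE -expr2.
rewrite psumr_eq0 => [/allP v0|j _]; last exact: sqr_ge0.
apply/rowP => j; rewrite [RHS]mxE; apply/eqP.
by have := v0 j (mem_index_enum _); rewrite sqrf_eq0.
Qed.

Lemma pseudo_inverse_mulmx (R : realType) (m n r : nat) (C : 'M[R]_(m, r))
    (B : 'M[R]_(r, n)) :
  row_full C -> row_free B ->
  is_pseudo_inverse (C *m B)
    (B^T *m invmx (B *m B^T) *m (invmx (C^T *m C) *m C^T)).
Proof.
move=> fullC freeB.
have uB : B *m B^T \in unitmx by exact: row_free_gram.
have uC : C^T *m C \in unitmx.
  rewrite -[X in _ *m X]trmxK; apply: row_free_gram.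
  by rewrite /row_free mxrank_tr.
pose P := B^T *m invmx (B *m B^T); pose Q := invmx (C^T *m C) *m C^T.
rewrite -/P -/Q.
have BP : B *m P = 1%:M by rewrite mulmxA mulmxV.
have QC : Q *m C = 1%:M by rewrite -mulmxA mulVmx.
have MX : C *m B *m (P *m Q) = C *m Q.
  by rewrite -mulmxA (mulmxA B) BP mul1mx.
have XM : (P *m Q) *m (C *m B) = P *m B.
  by rewrite -mulmxA (mulmxA Q) QC mul1mx.
split; rewrite ?MX ?XM.
- by rewrite -mulmxA (mulmxA Q) QC mul1mx.
- by rewrite -mulmxA (mulmxA B) BP mul1mx.
- by rewrite !trmx_mul trmxK trmx_inv trmx_mul trmxK mulmxA.
- by rewrite !trmx_mul trmxK trmx_inv trmx_mul trmxK mulmxA.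
Qed.

Lemma moore_penroseP (R : realType) (m n : nat) (M : 'M[R]_(m, n)) :
  is_pseudo_inverse M (moore_penrose M).
Proof.
apply: xgetPex; have := pseudo_inverse_mulmx (col_base_full M) (row_base_free M).
by rewrite mulmx_base => MP; eexists; exact: MP.
Qed.

Lemma pseudo_inverse_unique (R : realType) (m n : nat) (M : 'M[R]_(m, n))
    (X Y : 'M[R]_(n, m)) :
  is_pseudo_inverse M X -> is_pseudo_inverse M Y -> X = Y.
Proof.
move=> [MXM XMX sMX sXM] [MYM YMY sMY sYM].
have e1 : M *m X = M *m Y.
  rewrite -[LHS]sMX -{1}MYM -(mulmxA (M *m Y)) trmx_mul sMX sMY.
  by rewrite mulmxA MXM.
have e2 : X *m M = Y *m M.
  rewrite -[LHS]sXM -{1}MYM -(mulmxA M) mulmxA trmx_mul sXM sYM.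
  by rewrite -mulmxA (mulmxA M) MXM.
by rewrite -XMX e2 -mulmxA e1 mulmxA YMY.
Qed.

(* One block Gaussian Kaczmarz step with the sketching matrix S. *)
Definition bgk_step (R : realType) (m n s : nat) (A : 'M[R]_(m, n))
    (b : 'cV[R]_m) (S : 'M[R]_(m, s)) (x : 'cV[R]_n) : 'cV[R]_n :=
  (1%:M - moore_penrose (S^T *m A) *m (S^T *m A)) *m x
  + moore_penrose (S^T *m A) *m (S^T *m b).

Fixpoint bgk (R : realType) (m n s : nat) (A : 'M[R]_(m, n)) (b : 'cV[R]_m)
    (x0 : 'cV[R]_n) (S : nat -> 'M[R]_(m, s)) (k : nat) : 'cV[R]_n :=
  if k is k'.+1 then bgk_step A b (S k') (bgk A b x0 S k') else x0.

Definition mutually_independent (R : realType) (d : measure_display)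
    (T : measurableType d) (P : probability T R) (I : choiceType)
    (X : I -> {RV P >-> R}) : Prop :=
  forall (J : seq I) (B : I -> set R),
    uniq J -> (forall i, measurable (B i)) ->
    P [set w | forall i, i \in J -> B i (X i w)]
    = (\prod_(i <- J) P (X i @^-1` B i))%E.

(* g (k, i, j) is the (i, j) entry of the matrix drawn at iteration k. Mutual
   independence over all (k, i, j) covers both the entries of one matrix and
   the successive draws. *)
Definition iid_standard_normal (R : realType) (d : measure_display)
    (T : measurableType d) (P : probability T R) (m s : nat)
    (g : nat * 'I_m * 'I_s -> {RV P >-> R}) : Prop :=
  mutually_independent g /\
  (forall t (B : set R), measurable B ->
     distribution P (g t) B = normal_prob 0 1 B).

Definition sketch (R : realType) (d : measure_display) (T : measurableType d)
    (P : probability T R) (m s : nat) (g : nat * 'I_m * 'I_s -> {RV P >-> R})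
    (w : T) (k : nat) : 'M[R]_(m, s) :=
  \matrix_(i < m, j < s) g (k, i, j) w.

(* Main.v *)
Require Import Defs.
From HB Require Import structures.
From mathcomp Require Import all_boot all_order all_algebra.
From mathcomp Require Import all_classical all_reals all_analysis.
From mathcomp Require Import measurable_realfun.
From mathcomp Require Import ring lra.

Set Implicit Arguments.
Unset Strict Implicit.
Unset Printing Implicit Defensive.

Import Order.TTheory GRing.Theory Num.Theory.
Import numFieldNormedType.Exports.

Local Open Scope classical_set_scope.
Local Open Scope ring_scope.

(** Write [M = S^T A], [P] for the orthogonal projection onto the row space of
    [M], and [e = A xs - b], so that [A^T e = 0]. One step maps the error [v] to
    the sum of the orthogonal vectors [(1 - P) v] and [- M^+ S^T e]
    ([msq_bgk_step]). Since [S] is independent of the past, it is enough to bound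
    the expected squared norm of each of them for a fixed [v], and to sum a
    geometric series ([integral_iterate_le]).

    Contraction. [(1 - P) v] is the shortest vector of the form [v - M^T w], so
    it is no longer than what [s] gradient steps [z - t (a . z) a] make of [v],
    one for each row [a] of [M]. These steps are polynomial in independent
    Gaussian variables; second and fourth moments show that for
    [t = 1 / (3 F^2)], with [F] the Frobenius norm of [A], each of them
    multiplies the expected squared norm by at most [1 - sigma^2 / (3 F^2)]
    ([integral_compl_row_proj_le]). The [s]-th power of this number is at most
    [1 / (1 + s sigma^2 / (3 F^2))], and the rate follows ([rate_le]).

    Noise. Put [K = (M M^T + l)^-1]. Gaussian integration by parts says that the
    expectation of [<S, V(S)>] is that of the divergence of [V]
    ([expect_field]). The field [V = A (A^T A)^-1 A^T S K] yields
    [(n - s - 1) E (tr K) <= s / sigma^2] ([expect_tr_sketchK_le]). The field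
    [V = e e^T S K] yields [E <S^T e, K S^T e> = |e|^2 E (tr K)]: as [A^T e = 0],
    moving [S] along [e] does not change [K] ([expect_residual]). Finally
    [|M^T K S^T e|^2 <= <S^T e, K S^T e>], and [M^T K] tends to [M^+] as [l] tends
    to [0], so Fatou's lemma bounds [E |M^+ S^T e|^2] by
    [|e|^2 s / (sigma^2 (n - s - 1))] ([integral_pinv_residual_le]).

    Besides the normal distribution of each coordinate, one fact on the law of
    the draws is used, [mix_law]: redrawing any set of coordinates from an
    independent copy preserves the law. It separates an iteration from the
    previous ones, a column of a sketch from the others, and reduces integration
    by parts to one variable. *)

(** * Frobenius inner product, pseudo-inverse and its regularization *)

Section Frobenius.
Variable R : realType.

Definition mdot (p q : nat) (X Y : 'M[R]_(p, q)) : R := \tr (X^T *m Y).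
Definition msq (p q : nat) (X : 'M[R]_(p, q)) : R := mdot X X.

Lemma mdotE p q (X Y : 'M[R]_(p, q)) :
  mdot X Y = \sum_i \sum_j X i j * Y i j.
Proof.
rewrite /mdot /mxtrace exchange_big /=; apply: eq_bigr => j _.
by rewrite mxE; apply: eq_bigr => i _; rewrite mxE.
Qed.

Lemma msqE p q (X : 'M[R]_(p, q)) : msq X = \sum_i \sum_j X i j ^+ 2.
Proof. by rewrite /msq mdotE; do 2![apply: eq_bigr => ? _]; rewrite expr2. Qed.

Lemma mdotC p q (X Y : 'M[R]_(p, q)) : mdot X Y = mdot Y X.
Proof. by rewrite /mdot -mxtrace_tr trmx_mul trmxK. Qed.

Lemma mdotDl p q (X Y Z : 'M[R]_(p, q)) : mdot (X + Y) Z = mdot X Z + mdot Y Z.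
Proof. by rewrite /mdot linearD mulmxDl mxtraceD. Qed.

Lemma mdotNl p q (X Z : 'M[R]_(p, q)) : mdot (- X) Z = - mdot X Z.
Proof. by rewrite /mdot linearN mulNmx raddfN. Qed.

Lemma mdotZl p q a (X Z : 'M[R]_(p, q)) : mdot (a *: X) Z = a * mdot X Z.
Proof. by rewrite /mdot linearZ /= -scalemxAl linearZ. Qed.

Lemma mdotDr p q (X Y Z : 'M[R]_(p, q)) : mdot Z (X + Y) = mdot Z X + mdot Z Y.
Proof. by rewrite !(mdotC Z) mdotDl. Qed.

Lemma mdotNr p q (X Z : 'M[R]_(p, q)) : mdot Z (- X) = - mdot Z X.
Proof. by rewrite !(mdotC Z) mdotNl. Qed.

Lemma mdotZr p q a (X Z : 'M[R]_(p, q)) : mdot Z (a *: X) = a * mdot Z X.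
Proof. by rewrite !(mdotC Z) mdotZl. Qed.

Definition mdot_linear := (mdotDl, mdotDr, mdotNl, mdotNr, mdotZl, mdotZr).

Lemma mdot_mull p q r (A : 'M[R]_(p, q)) (X : 'M[R]_(q, r)) (Y : 'M[R]_(p, r)) :
  mdot (A *m X) Y = mdot X (A^T *m Y).
Proof. by rewrite /mdot trmx_mul mulmxA. Qed.

Lemma msq_ge0 p q (X : 'M[R]_(p, q)) : 0 <= msq X.
Proof. by rewrite msqE; do 2![apply: sumr_ge0 => ? _]; exact: sqr_ge0. Qed.

Lemma msq_eq0 p q (X : 'M[R]_(p, q)) : msq X = 0 -> X = 0.
Proof.
rewrite msqE => /eqP; rewrite psumr_eq0 => [/allP X0|i _]; last first.
  by apply: sumr_ge0 => ? _; exact: sqr_ge0.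
apply/matrixP => i j; rewrite mxE; apply/eqP.
have := X0 i (mem_index_enum _).
rewrite psumr_eq0 => [/allP/(_ j (mem_index_enum _))|? _]; last exact: sqr_ge0.
by rewrite sqrf_eq0.
Qed.

Lemma msq0 p q : msq (0 : 'M[R]_(p, q)) = 0.
Proof. by rewrite /msq /mdot mulmx0 mxtrace0. Qed.

Lemma msqN p q (X : 'M[R]_(p, q)) : msq (- X) = msq X.
Proof. by rewrite /msq !mdot_linear opprK. Qed.

Lemma msqZ p q a (X : 'M[R]_(p, q)) : msq (a *: X) = a ^+ 2 * msq X.
Proof. by rewrite /msq !mdot_linear mulrA expr2. Qed.

Lemma msqD p q (X Y : 'M[R]_(p, q)) :
  msq (X + Y) = msq X + 2 * mdot X Y + msq Y.
Proof. by rewrite /msq !mdot_linear (mdotC Y X); ring. Qed.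

Lemma le_entry_msq p q (X : 'M[R]_(p, q)) i j : X i j ^+ 2 <= msq X.
Proof.
rewrite msqE (bigD1 i)//= (bigD1 j)//= -addrA lerDl.
by rewrite addr_ge0// sumr_ge0// => ? _; rewrite ?sumr_ge0// => *; exact: sqr_ge0.
Qed.

Lemma mdot_CS p q (X Y : 'M[R]_(p, q)) : mdot X Y ^+ 2 <= msq X * msq Y.
Proof.
have [Y0|Y0] := eqVneq (msq Y) 0.
  by rewrite (msq_eq0 Y0) msq0 mulr0 /mdot mulmx0 mxtrace0 expr0n.
have Ygt0 : 0 < msq Y by rewrite lt_neqAle eq_sym Y0 msq_ge0.
have := msq_ge0 (msq Y *: X + (- mdot X Y) *: Y).
rewrite msqD !msqZ !mdot_linear.
set a := msq X; set b := msq Y; set c := mdot X Y.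
have -> : b ^+ 2 * a + 2 * (b * (- c * c)) + (- c) ^+ 2 * b =
  b * (a * b - c ^+ 2) by ring.
by rewrite pmulr_rge0// subr_ge0.
Qed.

Lemma msq_mulmx p q r (A : 'M[R]_(p, q)) (X : 'M[R]_(q, r)) :
  msq (A *m X) <= msq A * msq X.
Proof.
rewrite !msqE mulr_suml; apply: ler_sum => i _.
rewrite exchange_big /= mulr_sumr; apply: ler_sum => j _; rewrite mxE.
have := mdot_CS (row i A)^T (col j X).
rewrite !msqE !mdotE /=.
under eq_bigr do rewrite big_ord1 !mxE.
under [X in _ <= X * _]eq_bigr do rewrite big_ord1 !mxE.
by under [X in _ <= _ * X]eq_bigr do rewrite big_ord1 !mxE.
Qed.

Lemma norm2_sqr n (x : 'cV[R]_n) : norm2 x ^+ 2 = msq x.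
Proof.
rewrite /norm2 sqr_sqrtr ?sumr_ge0// => [|*]; last exact: sqr_ge0.
by rewrite msqE; apply: eq_bigr => i _; rewrite big_ord1.
Qed.

Lemma frobenius_sqr m n (A : 'M[R]_(m, n)) : frobenius A ^+ 2 = msq A.
Proof. by rewrite /frobenius sqr_sqrtr//; exact: (msq_ge0 A). Qed.

End Frobenius.

Section PseudoInverse.
Variables (R : realType) (s n : nat) (M : 'M[R]_(s, n)).
Local Notation X := (moore_penrose M).

Lemma row_proj_tr : (X *m M)^T = X *m M.
Proof. by case: (moore_penroseP M). Qed.

Lemma pinv_mul_gram : X *m (M *m M^T) = M^T.
Proof.
case: (moore_penroseP M) => h1 h2 h3 h4.
by rewrite mulmxA -h4 -trmx_mul mulmxA h1.
Qed.

Lemma compl_row_proj_pinv : (1%:M - X *m M) *m X = 0.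
Proof.
case: (moore_penroseP M) => h1 h2 h3 h4.
by rewrite mulmxBl mul1mx h2 subrr.
Qed.

(** The left side is the squared distance from [y] to the row space of [M]. *)
Lemma msq_compl_row_proj (y : 'cV[R]_n) (w : 'cV[R]_s) :
  msq ((1%:M - X *m M) *m y) <= msq (y - M^T *m w).
Proof.
case: (moore_penroseP M) => h1 h2 h3 h4.
set Q := 1%:M - X *m M.
have QT : Q^T = Q by rewrite /Q linearB /= h4 trmx1.
have QX : Q *m (X *m M) = 0 by rewrite mulmxA compl_row_proj_pinv mul0mx.
have QM : Q *m M^T = 0.
  by rewrite -[Q]QT -trmx_mul mulmxBr mulmx1 mulmxA h1 subrr trmx0.
have -> : Q *m y = Q *m (y - M^T *m w) by rewrite mulmxBr mulmxA QM mul0mx subr0.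
set v := y - _.
have -> : msq v = msq (Q *m v) + msq (X *m M *m v).
  have {1}-> : v = Q *m v + X *m M *m v by rewrite -mulmxDl subrK mul1mx.
  rewrite msqD [mdot _ _]mdot_mull QT (mulmxA Q) QX mul0mx.
  by rewrite /mdot mulmx0 mxtrace0 mulr0 addr0.
by rewrite lerDl msq_ge0.
Qed.

End PseudoInverse.

Section Regularized.
Variables (R : realType) (s n : nat) (M : 'M[R]_(s, n)) (l : R).
Hypothesis l0 : 0 < l.

(** Regularization makes the inverse of the Gram matrix of the rows of [M] defined
    everywhere, bounded by [1 / l] and smooth in [M]. *)
Definition regN : 'M[R]_s := M *m M^T + l%:M.
Definition regK : 'M[R]_s := invmx regN.

Lemma msq_regN (v : 'cV[R]_s) : l ^+ 2 * msq v <= msq (regN *m v).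
Proof.
rewrite /regN mulmxDl mul_scalar_mx msqD msqZ mdotZr -mulmxA (mdot_mull M).
rewrite lerDr addr_ge0 ?msq_ge0//.
by rewrite mulr_ge0// mulr_ge0 ?(ltW l0) ?(msq_ge0 (M^T *m v)).
Qed.

Lemma regN_unit : regN \in unitmx.
Proof.
rewrite -unitmx_tr -row_free_unit -kermx_eq0; apply/rowV0P => u /sub_kermxP uN.
have /(congr1 trmx) := uN; rewrite trmx_mul trmxK trmx0 => Nu.
have := msq_regN u^T; rewrite Nu msq0 pmulr_rle0 ?exprn_gt0// => u0.
apply/trmx_inj; rewrite trmx0; apply: msq_eq0.
by apply/eqP; rewrite eq_le u0 msq_ge0.
Qed.

Lemma regN_tr : regN^T = regN.
Proof. by rewrite /regN linearD /= trmx_mul trmxK tr_scalar_mx. Qed.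

Lemma regK_tr : regK^T = regK.
Proof. by rewrite /regK trmx_inv regN_tr. Qed.

Lemma mul_regNK : regN *m regK = 1%:M. Proof. exact: mulmxV regN_unit. Qed.
Lemma mul_regKN : regK *m regN = 1%:M. Proof. exact: mulVmx regN_unit. Qed.

Lemma msq_regK (v : 'cV[R]_s) : msq (regK *m v) <= l ^- 2 * msq v.
Proof.
have := msq_regN (regK *m v); rewrite mulmxA mul_regNK mul1mx.
by rewrite mulrC -ler_pdivlMr ?exprn_gt0// mulrC.
Qed.


Lemma regK_entry i j : `|regK i j| <= l^-1.
Proof.
have d1 : msq (delta_mx j 0 : 'cV[R]_s) = 1.
  rewrite msqE (bigD1 j)//= big_ord1 mxE !eqxx expr1n big1 ?addr0// => k kj.
  by rewrite big_ord1 mxE (negbTE kj) expr0n.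
rewrite -(@ler_pXn2r _ 2)// ?nnegrE ?invr_ge0 ?(ltW l0)//.
rewrite real_normK ?num_real//.
have := le_trans (le_entry_msq (col j regK) i 0) _; rewrite mxE; apply.
by rewrite colE (le_trans (msq_regK _))// d1 mulr1 exprVn.
Qed.

Lemma mul_gramK : M *m M^T *m regK = 1%:M - l *: regK.
Proof.
by rewrite -{1}mul_regNK /regN mulmxDl mul_scalar_mx addrK.
Qed.

(** [K = K (M M^T + l) K] exhibits [K] as a sum of two Gram matrices. *)
Lemma regK_sum : regK = regK *m M *m (regK *m M)^T + l *: (regK *m regK^T).
Proof.
rewrite trmx_mul regK_tr -[LHS]mulmx1 -mul_regNK mulmxA.
by rewrite /regN mulmxDr mulmxDl mul_mx_scalar -scalemxAl !mulmxA.
Qed.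

Lemma tr_regK_ge0 : 0 <= \tr regK.
Proof.
rewrite regK_sum mxtraceD mxtraceZ !(mxtrace_mulC _ _^T).
by rewrite addr_ge0 ?mulr_ge0 ?(ltW l0)// msq_ge0.
Qed.

Lemma tr_gramK_le : \tr (M *m M^T *m regK) <= s%:R.
Proof.
rewrite mul_gramK raddfB /= mxtrace1 mxtraceZ gerBl.
by rewrite mulr_ge0 ?tr_regK_ge0 ?(ltW l0).
Qed.

Lemma tr_regK_gramK_le : \tr (regK *m (M *m M^T) *m regK) <= \tr regK.
Proof.
rewrite -mulmxA mul_gramK mulmxBr mulmx1 -scalemxAr raddfB /= mxtraceZ gerBl.
rewrite mulr_ge0 ?(ltW l0)// -{1}regK_tr; exact: msq_ge0.
Qed.

(** This is [K W K <= K] for [W = M M^T]: indeed [K = K W K + l K K]. *)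
Lemma msq_trM_regK_le (v : 'cV[R]_s) : msq (M^T *m regK *m v) <= mdot v (regK *m v).
Proof.
have {2}-> : regK = regK *m (M *m M^T) *m regK + l *: (regK *m regK).
  by rewrite -mulmxA mul_gramK mulmxBr mulmx1 -scalemxAr subrK.
rewrite mulmxDl mdotDr.
have -> : msq (M^T *m regK *m v) = mdot v (regK *m (M *m M^T) *m regK *m v).
  by rewrite /msq mdot_mull trmx_mul trmxK regK_tr !mulmxA.
rewrite lerDl -scalemxAl mdotZr mulr_ge0 ?(ltW l0)// -mulmxA -{1}regK_tr -mdot_mull.
exact: msq_ge0.
Qed.

(** A form of [moore_penrose M - M^T K = O(l)] with an explicit remainder. *)
Lemma trM_regKE : let X := moore_penrose M in let Q := X *m X^T *m X in
  M^T *m regK = X - l *: Q + (l ^+ 2) *: (Q *m regK).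
Proof.
move=> X Q.
have QW : X = Q *m (M *m M^T).
  rewrite /Q -mulmxA pinv_mul_gram.
  case: (moore_penroseP M) => h1 h2 h3 h4.
  by rewrite -[LHS]h2 -mulmxA -h3 trmx_mul mulmxA.
have XK : X *m regK = Q - l *: (Q *m regK).
  by rewrite {1}QW -mulmxA mul_gramK mulmxBr mulmx1 -scalemxAr.
rewrite -[in LHS]pinv_mul_gram -/X -mulmxA mul_gramK mulmxBr mulmx1 -scalemxAr XK.
by rewrite scalerBr opprB scalerA -expr2 addrA addrAC.
Qed.

End Regularized.

Lemma cvg_entry_mulmx (R : realType) (U : Type) (D : set_system U)
    (p q r : nat) (F : U -> 'M[R]_(p, q)) (G : U -> 'M[R]_(q, r))
    (X : 'M[R]_(p, q)) (Y : 'M[R]_(q, r)) : Filter D ->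
  (forall i j, F k i j @[k --> D] --> X i j) ->
  (forall i j, G k i j @[k --> D] --> Y i j) ->
  forall i j, (F k *m G k) i j @[k --> D] --> (X *m Y) i j.
Proof.
move=> FD.
move=> cF cG i j; rewrite mxE.
under eq_fun do rewrite mxE.
apply: cvg_big => [|c _]; first exact: add_continuous.
by apply: cvgM.
Qed.

(** The matrices [M^T (M M^T + l)^-1] are rational in the entries of [M], with a
    nonzero denominator, and converge whatever the rank of [M]: measurability
    and, by Fatou, bounds on expectations pass to the pseudo-inverse. *)
Lemma cvg_regK_pinv (R : realType) (s n : nat) (M : 'M[R]_(s, n)) i j :
  (M^T *m regK M k.+1%:R^-1) i j @[k --> \oo] --> moore_penrose M i j.
Proof.
set X := moore_penrose M; pose Q := X *m X^T *m X.
pose l (k : nat) : R := k.+1%:R^-1.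
have l0 k : 0 < l k by rewrite invr_gt0.
have cl : l k @[k --> \oo] --> 0 by exact: cvg_harmonic.
have E k : (M^T *m regK M (l k)) i j =
    X i j - l k * Q i j + l k ^+ 2 * (Q *m regK M (l k)) i j.
  by rewrite trM_regKE// !mxE.
rewrite (_ : (fun k : nat => _) = fun k =>
  X i j - l k * Q i j + l k ^+ 2 * (Q *m regK M (l k)) i j); last exact/funext.
rewrite -[X in _ --> X]addr0 -[X in _ --> X + _]subr0.
rewrite -[X in _ --> _ - X + _](mul0r (Q i j)).
apply: cvgD; first by apply: cvgB; [exact: cvg_cst|apply: cvgM => //; exact: cvg_cst].
pose c : R := \sum_a `|Q i a|.
have lc (b : R) : l k * b @[k --> \oo] --> 0.
  by rewrite -[X in _ --> X](mul0r b); apply: cvgM => //; exact: cvg_cst.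
apply: (@squeeze_cvgr _ _ _ _ (fun k => l k * - c) (fun k => l k * c)) => //.
apply: nearW => k; rewrite mulrN -ler_norml expr2 -mulrA normrM.
rewrite ger0_norm ?(ltW (l0 _))// ler_pM2l// normrM ger0_norm ?(ltW (l0 _))//.
rewrite mulrC -ler_pdivlMr ?l0// mxE (le_trans (ler_norm_sum _ _ _))// mulr_suml.
by apply: ler_sum => a _; rewrite normrM ler_wpM2l//; exact: regK_entry.
Qed.

(** * The smallest singular value *)

Section SmallestSingularValue.
Variables (R : realType) (m n : nat) (A : 'M[R]_(m, n)).
Hypothesis n0 : (0 < n)%N.

Let unit_vector : exists y : 'cV[R]_n, msq y = 1.
Proof.
case: n n0 A => // n' _ _; exists (delta_mx ord0 0).
rewrite msqE (bigD1 ord0)//= big_ord1 mxE !eqxx expr1n big1 ?addr0// => k kj.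
by rewrite big_ord1 mxE (negbTE kj) expr0n.
Qed.

(** The infimum [L] of the Rayleigh quotient is shown to be the smallest
    eigenvalue of [A^T A]. *)
Let rayleigh := [set msq (A *m y) | y in [set y : 'cV[R]_n | msq y = 1]].
Let L := inf rayleigh.

Let L_lb (y : 'cV[R]_n) : msq y = 1 -> L <= msq (A *m y).
Proof.
move=> y1; apply: ge_inf; last by exists y.
by exists 0 => _ [z _ <-]; exact: msq_ge0.
Qed.

Let L_ge0 : 0 <= L.
Proof.
apply: lb_le_inf; last by move=> _ [z _ <-]; exact: msq_ge0.
by have [y y1] := unit_vector; exists (msq (A *m y)), y.
Qed.

Let L_le (y : 'cV[R]_n) : L * msq y <= msq (A *m y).
Proof.
have [y0|y0] := eqVneq (msq y) 0; first by rewrite y0 mulr0 msq_ge0.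
have ygt0 : 0 < msq y by rewrite lt_neqAle eq_sym y0 msq_ge0.
have := @L_lb ((Num.sqrt (msq y))^-1 *: y).
rewrite -scalemxAr !msqZ exprVn sqr_sqrtr ?msq_ge0// mulVf// => /(_ erefl).
by rewrite mulrC ler_pdivlMr.
Qed.

Let N := A^T *m A - L%:M.

Let formN (x y : 'cV[R]_n) : mdot x (N *m y) = mdot (A *m x) (A *m y) - L * mdot x y.
Proof.
by rewrite /N mulmxBl mul_scalar_mx !mdot_linear -mulmxA mdot_mull.
Qed.

Let NT : N^T = N.
Proof. by rewrite /N linearB /= trmx_mul trmxK tr_scalar_mx. Qed.

(** Cauchy-Schwarz for the nonnegative form of [N]. *)
Let msqN_le (y : 'cV[R]_n) : msq (N *m y) <= msq A * mdot y (N *m y).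
Proof.
have q0 (x : 'cV[R]_n) : 0 <= mdot x (N *m x) by rewrite formN subr_ge0 L_le.
have qA (x : 'cV[R]_n) : mdot x (N *m x) <= msq A * msq x.
  by rewrite formN (le_trans _ (msq_mulmx A x))// gerBl mulr_ge0// msq_ge0.
have [z0|z0] := eqVneq (msq (N *m y)) 0.
  by rewrite z0 mulr_ge0 ?msq_ge0.
have zgt0 : 0 < msq (N *m y) by rewrite lt_neqAle eq_sym z0 msq_ge0.
have [A0|A0] := eqVneq (msq A) 0.
  have : msq (N *m y) = - (L * mdot (N *m y) y).
    by rewrite /msq formN (msq_eq0 A0) mul0mx /mdot trmx0 mul0mx mxtrace0 sub0r.
  have L0 : L = 0.
    apply/eqP; rewrite eq_le L_ge0 andbT.
    have [x x1] := unit_vector; have := L_le x.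
    by rewrite x1 mulr1 (msq_eq0 A0) mul0mx msq0.
  by rewrite L0 mul0r oppr0 => /eqP; rewrite (negbTE z0).
have Agt0 : 0 < msq A by rewrite lt_neqAle eq_sym A0 msq_ge0.
have := q0 (msq A *: y - N *m y).
rewrite mulmxBr -scalemxAr !mdot_linear.
have -> : mdot y (N *m (N *m y)) = msq (N *m y) by rewrite -{1}NT -mdot_mull.
have := qA (N *m y).
set a := msq A; set z := msq (N *m y); set q := mdot y _; set r := mdot _ (_ *m _).
rewrite -/(msq _) -/z => rz h.
rewrite -(ler_pM2l Agt0) -/a; nra.
Qed.

(** Were [N = A^T A - L] invertible, the previous inequality would make its form
    coercive, and the Rayleigh quotient would stay above [L + 1 / c]. *)
Let eigenL : eigenvalue (A^T *m A) L.
Proof.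
rewrite /eigenvalue /eigenspace -/N kermx_eq0 row_free_unit.
apply/negP => uN.
pose c := msq (invmx N) * msq A.
have yc (y : 'cV[R]_n) : msq y <= c * mdot y (N *m y).
  have {1}-> : y = invmx N *m (N *m y) by rewrite mulmxA mulVmx// mul1mx.
  by rewrite (le_trans (msq_mulmx _ _))// -mulrA ler_wpM2l ?msq_ge0 ?msqN_le.
have cgt0 : 0 < c.
  have [y y1] := unit_vector; have := yc y; rewrite y1.
  have : 0 <= c by rewrite mulr_ge0 ?msq_ge0.
  by rewrite le_eqVlt => /predU1P[<-|//]; rewrite mul0r ler10.
suff : L + c^-1 <= L by rewrite gerDl invr_le0 leNgt cgt0.
apply: lb_le_inf.
  by have [y y1] := unit_vector; exists (msq (A *m y)), y.
move=> _ [y y1 <-]; have := yc y; rewrite formN y1 -/(msq _) -/(msq y) y1 mulr1.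
by rewrite mulrC -ler_pdivrMr// div1r lerBrDl.
Qed.

Let eigen_msq a : eigenvalue (A^T *m A) a ->
  exists2 v : 'cV[R]_n, v != 0 & msq (A *m v) = a * msq v.
Proof.
case/eigenvalueP => v vA v0; exists v^T; first by rewrite trmx_eq0.
have E : A^T *m A *m v^T = a *: v^T.
  by rewrite -linearZ /= -vA !trmx_mul trmxK.
by rewrite /msq mdot_mull mulmxA E mdotZr.
Qed.

Lemma sigma_min_sqrE : sigma_min A ^+ 2 = L.
Proof.
suff -> : sigma_min A = Num.sqrt L by rewrite sqr_sqrtr.
apply/eqP; rewrite eq_le /sigma_min /singular_values; apply/andP; split.
  apply: ge_inf; last by exists L.
  by exists 0 => _ [a _ <-]; exact: sqrtr_ge0.
apply: lb_le_inf; first by exists (Num.sqrt L), L.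
move=> _ [a /eigen_msq [v v0 Ev] <-]; rewrite ler_wsqrtr//.
have vgt0 : 0 < msq v.
  rewrite lt_neqAle msq_ge0 andbT eq_sym; apply: contra_neq v0; exact: msq_eq0.
by have := L_le v; rewrite Ev ler_pM2r.
Qed.

Lemma sigma_min_le (y : 'cV[R]_n) : sigma_min A ^+ 2 * msq y <= msq (A *m y).
Proof. by rewrite sigma_min_sqrE. Qed.

Lemma sigma_min_gt0 : \rank A = n -> 0 < sigma_min A.
Proof.
move=> rA.
have [v v0 Ev] := eigen_msq eigenL.
have Av0 : A *m v != 0.
  apply: contra_neq v0 => Av; apply/trmx_inj; rewrite trmx0.
  have freeA : row_free A^T by rewrite /row_free mxrank_tr rA.
  by apply: (row_free_inj freeA); rewrite mul0mx -trmx_mul Av trmx0.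
have sge0 : 0 <= sigma_min A.
  apply: lb_le_inf; first by exists (Num.sqrt L), L; first exact: eigenL.
  by move=> _ [a _ <-]; exact: sqrtr_ge0.
rewrite lt_neqAle sge0 andbT; apply: contra_neq Av0 => s0.
by apply: msq_eq0; rewrite Ev -sigma_min_sqrE -s0 expr0n mul0r.
Qed.

Lemma sigma_min_op_norm : sigma_min A <= op_norm A.
Proof.
have [y y1] := unit_vector.
have norm2E p (x : 'cV[R]_p) : norm2 x = Num.sqrt (msq x).
  by rewrite -norm2_sqr sqrtr_sqr ger0_norm// sqrtr_ge0.
apply: (@le_trans _ _ (norm2 (A *m y))).
  rewrite -(@ler_pXn2r _ 2)// ?nnegrE ?sqrtr_ge0//; last first.
    apply: lb_le_inf; first by exists (Num.sqrt L), L; first exact: eigenL.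
    by move=> _ [a _ <-]; exact: sqrtr_ge0.
  by rewrite norm2_sqr sigma_min_sqrE L_lb.
apply: ub_le_sup; last by exists y => //=; rewrite norm2E y1 sqrtr1.
exists (frobenius A) => _ [z z1 <-].
rewrite -(@ler_pXn2r _ 2)// ?nnegrE ?sqrtr_ge0//.
rewrite norm2_sqr frobenius_sqr (le_trans (msq_mulmx _ _))//.
by rewrite -norm2_sqr z1 expr1n mulr1.
Qed.

End SmallestSingularValue.

(** First-order optimality, tested along the gradient [v] itself. *)
Lemma least_squares_orthogonal (R : realType) m n (A : 'M[R]_(m, n)) b xs :
  is_least_squares A b xs -> A^T *m (A *m xs - b) = 0.
Proof.
move=> ls; set e := A *m xs - b; set v := A^T *m e; apply: msq_eq0; apply/eqP.
rewrite eq_le msq_ge0 andbT.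
have h t : 0 <= - (2 * t) * msq v + t ^+ 2 * msq (A *m v).
  have := ls (xs - t *: v); rewrite !norm2_sqr -/e.
  have -> : A *m (xs - t *: v) - b = e + (- t) *: (A *m v).
    by rewrite mulmxBr -scalemxAr scaleNr /e addrAC.
  rewrite -subr_ge0 msqD msqZ mdotZr sqrrN mdotC mdot_mull -/v -/(msq v).
  by set a := msq e; set c := msq v; set d := msq _; lra.
have [d0|d0] := eqVneq (msq (A *m v)) 0.
  have := h 1; rewrite d0; lra.
have dgt0 : 0 < msq (A *m v) by rewrite lt_neqAle eq_sym d0 msq_ge0.
have := h (msq v / msq (A *m v)); set c := msq v; set d := msq _ in d0 dgt0 *.
have -> : - (2 * (c / d)) * c + (c / d) ^+ 2 * d = - (c ^+ 2 / d).
  by field.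
rewrite oppr_ge0 pmulr_lle0 ?invr_gt0// => c2.
have : c ^+ 2 == 0 by rewrite eq_le c2 sqr_ge0.
by rewrite sqrf_eq0 => /eqP ->.
Qed.

(** * Independent Gaussian families *)

(** A name that carries the probability structure on [measurableTypeR R]. *)
Definition gauss (R : realType) : probability (measurableTypeR R) R :=
  normal_prob 0 1.

Section Configurations.
Variables (R : realType) (I : choiceType).

Definition cylinder (J : seq I) (B : I -> set R) : set (I -> R) :=
  [set c | forall i, i \in J -> B i (c i)].

Definition cylinders : set (set (I -> R)) :=
  [set E | exists J B, (forall i, measurable (B i)) /\ E = cylinder J B].

(** [I -> R] with the sigma-algebra generated by the coordinates. *)
Definition config := g_sigma_algebraType cylinders.
HB.instance Definition _ := Measurable.on config.

Lemma setI_cylinders : setI_closed cylinders.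
Proof.
move=> _ _ [J1 [B1 [mB1 ->]]] [J2 [B2 [mB2 ->]]].
exists (J1 ++ J2); exists (fun i => (if i \in J1 then B1 i else setT) `&`
                   (if i \in J2 then B2 i else setT)); split.
  by move=> i; apply: measurableI; case: ifP.
apply/seteqP; split => c.
  by move=> [c1 c2] i _; split; case: ifP => // ?; [exact: c1|exact: c2].
move=> c12; split => i iJ.
  by have [|+ _] := c12 i; rewrite ?mem_cat iJ.
by have [|_] := c12 i; rewrite ?mem_cat iJ ?orbT.
Qed.

Lemma measurable_cylinder J B : (forall i, measurable (B i)) ->
  measurable (cylinder J B : set config).
Proof. by move=> mB; apply: sub_sigma_algebra; exists J, B. Qed.

Lemma measurable_coord (i : I) : measurable_fun setT (fun c : config => c i).
Proof.
move=> _ B mB; rewrite setTI.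
rewrite (_ : _ @^-1` _ = cylinder [:: i] (fun=> B)).
  exact: measurable_cylinder.
apply/seteqP; split=> c /=; first by move=> Bc j; rewrite inE => /eqP ->.
by apply; rewrite mem_head.
Qed.

Lemma measurable_to_config d (T : measurableType d) (f : T -> config) :
  (forall i, measurable_fun setT (fun w => f w i)) -> measurable_fun setT f.
Proof.
move=> mf; apply: (@measurability _ _ T config setT f cylinders) => //.
move=> _ [_ [J [B [mB ->]]] <-]; rewrite setTI.
rewrite (_ : _ @^-1` _ = \big[setI/setT]_(i <- J) ((fun w => f w i) @^-1` B i)).
  by apply: bigsetI_measurable => i _; rewrite -[_ @^-1` _]setTI; exact: mf.
rewrite -bigcap_seq; apply/seteqP; split => w /=; first by move=> h i /h.
by move=> h i /h.
Qed.

Definition mix (U : pred I) (c c' : config) : config :=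
  fun i => if U i then c' i else c i.

Lemma measurable_mix (U : pred I) :
  measurable_fun setT (fun z : config * config => mix U z.1 z.2).
Proof.
apply: measurable_to_config => i; rewrite /mix; case: (U i).
  exact: (measurableT_comp (measurable_coord i) measurable_snd).
exact: (measurableT_comp (measurable_coord i) measurable_fst).
Qed.

(** Independence and the marginals at once; cylinders being stable under
    intersection, this determines [mu]. *)
Definition gaussian_law (mu : set config -> \bar R) := forall J B, uniq J ->
  (forall i, measurable (B i)) ->
  mu (cylinder J B) = (\prod_(i <- J) normal_prob 0 1 (B i))%E.

Variable mu : probability config R.
Hypothesis mu_gauss : gaussian_law mu.
Local Open Scope ereal_scope.

(** Redrawing independently the coordinates in [U] does not change the law: on a
    cylinder the product over [J] splits along [U]. All the independence used
    later, between iterations, columns or entries, is an instance of this. *)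
Lemma mix_law (U : pred I) (A : set config) : measurable A ->
  mu A = pushforward (mu \x mu) (fun z => mix U z.1 z.2) A.
Proof.
have mm := measurable_mix U.
pose f (z : config * config) := mix U z.1 z.2.
pose nu0 : {measure set config -> \bar R} := pushforward (mu \x mu) f.
pose nu := nu0 mm.
pose mu0 : {measure set config -> \bar R} := mu.
move=> mA; have : mu0 A = nu A; last by [].
move: A mA.
apply: (@measure_unique _ R config cylinders (fun=> setT) _ _ _ _ mu0 nu) => //.
- exact: setI_cylinders.
- move=> _; exists [::], (fun=> setT); split=> //.
  by apply/seteqP; split.
- by apply/seteqP; split => // c _; exists 0%N.
- move=> _ [J0 [B [mB ->]]].
  have -> : cylinder J0 B = cylinder (undup J0) B.
    by apply/seteqP; split => c h i iJ; apply: h; rewrite mem_undup in iJ *.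
  move: (undup J0) (undup_uniq J0) => J uJ {J0}.
  transitivity ((mu \x mu) (f @^-1` cylinder J B)); last by [].
  rewrite (_ : _ @^-1` _ = cylinder [seq i <- J | ~~ U i] B `*`
                          cylinder [seq i <- J | U i] B); last first.
    apply/seteqP; split => -[c c'] /=.
      move=> h; split => i /=; rewrite mem_filter => /andP[Ui iJ].
        by have := h i iJ; rewrite /f /mix /= (negbTE Ui).
      by have := h i iJ; rewrite /f /mix /= Ui.
    move=> [h1 h2] i iJ; rewrite /f /mix /=; case: ifP => Ui.
      by apply: h2; rewrite mem_filter Ui.
    by apply: h1; rewrite mem_filter Ui.
  rewrite product_measure1E; [|exact: measurable_cylinder..].
  rewrite /mu0 /= mu_gauss//.
  transitivity ((\prod_(i <- [seq i <- J | ~~ U i]) normal_prob 0 1 (B i)) *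
    (\prod_(i <- [seq i <- J | U i]) normal_prob 0 1 (B i))).
    by rewrite !big_filter [RHS]muleC [LHS](bigID U).
  by rewrite -!mu_gauss ?filter_uniq.
- by move=> k; rewrite /mu0 /= [X in X < _](_ : _ = 1) ?ltry//; exact: probability_setT.
Qed.

Lemma ge0_integral_mix (U : pred I) (H : config -> \bar R) : measurable_fun setT H ->
  (forall c, 0 <= H c) ->
  \int[mu]_c H c = \int[mu]_c \int[mu]_c' H (mix U c c').
Proof.
move=> mH H0; have mm := measurable_mix U.
rewrite -(fubini_tonelli1 (fun z => H (mix U z.1 z.2))) => [||//]; last first.
  exact: measurableT_comp mH mm.
transitivity (\int[pushforward (mu \x mu) (fun z => mix U z.1 z.2)]_c H c).
  by apply: eq_measure_integral => A mA _; rewrite [LHS](mix_law U mA).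
by rewrite (ge0_integral_pushforward mm).
Qed.

Lemma le_integral_mix (U : pred I) (H G : config -> \bar R) :
  measurable_fun setT H -> (forall c, 0 <= H c) -> measurable_fun setT G ->
  (forall c, \int[mu]_c' H (mix U c c') <= G c) ->
  \int[mu]_c H c <= \int[mu]_c G c.
Proof.
move=> mH H0 mG HG; rewrite (ge0_integral_mix U mH H0).
have I0 c : 0 <= \int[mu]_c' H (mix U c c') by exact: integral_ge0.
apply: ge0_le_integral => //.
apply: (measurable_fun_fubini_tonelli_F (fun z => H (mix U z.1 z.2))) => //.
exact: measurableT_comp mH (measurable_mix U).
Qed.

Lemma integral_mix (U : pred I) (H : config -> \bar R) : mu.-integrable setT H ->
  \int[mu]_c H c = \int[mu]_c \int[mu]_c' H (mix U c c').
Proof.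
move=> iH; have mm := measurable_mix U; have mH := measurable_int _ iH.
have iHm : (mu \x mu).-integrable setT (fun z => H (mix U z.1 z.2)).
  apply/integrableP; split; first exact: measurableT_comp mH mm.
  rewrite (fubini_tonelli1 (fun z => `|H (mix U z.1 z.2)|))//; last first.
    by apply: measurableT_comp => //; exact: measurableT_comp mH mm.
  rewrite -(@ge0_integral_mix U (fun c => `|H c|)) => [||//]; last first.
    exact: measurableT_comp.
  by case/integrableP : iH.
transitivity (\int[pushforward (mu \x mu) (fun z => mix U z.1 z.2)]_c H c).
  by apply: eq_measure_integral => A mA _; rewrite [LHS](mix_law U mA).
by rewrite integral_pushforward// -(integral12_prod_meas1 iHm).
Qed.

Lemma coord_law t (A : set R) : measurable A ->
  mu [set c | A (c t)] = normal_prob 0 1 A.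
Proof.
move=> mA; rewrite (_ : [set c | _] = cylinder [:: t] (fun=> A)).
  by rewrite mu_gauss// big_seq1.
apply/seteqP; split=> c /=; first by move=> Bc j; rewrite inE => /eqP ->.
by apply; rewrite mem_head.
Qed.

Lemma ge0_integral_coord t (f : measurableTypeR R -> \bar R) : measurable_fun setT f ->
  (forall x, 0 <= f x) ->
  \int[mu]_c f (c t) = \int[gauss R]_x f x.
Proof.
move=> mf f0; 
have mt : measurable_fun setT (fun c : config => c t : measurableTypeR R).
  exact: measurable_coord.
pose nu0 : {measure set (measurableTypeR R) -> \bar R} := 
  pushforward mu (fun c : config => c t : measurableTypeR R).
transitivity (\int[nu0 mt]_x f x); last first.
  apply/esym/(@eq_measure_integral _ _ _ setT (nu0 mt) (gauss R)).
  by move=> A mA _; exact/esym/coord_law.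
by rewrite (ge0_integral_pushforward mt).
Qed.

Lemma integral_coord t (f : measurableTypeR R -> \bar R) :
  (gauss R).-integrable setT f ->
  \int[mu]_c f (c t) = \int[gauss R]_x f x.
Proof.
move=> /integrableP[mf fi]; 
have mt : measurable_fun setT (fun c : config => c t : measurableTypeR R).
  exact: measurable_coord.
pose nu0 : {measure set (measurableTypeR R) -> \bar R} := 
  pushforward mu (fun c : config => c t : measurableTypeR R).
transitivity (\int[nu0 mt]_x f x); last first.
  apply/esym/(@eq_measure_integral _ _ _ setT (nu0 mt) (gauss R)).
  by move=> A mA _; exact/esym/coord_law.
rewrite (integral_pushforward mt)//.
apply/integrableP; split; first exact: measurableT_comp mf mt.
rewrite [ltLHS](ge0_integral_coord t (f := fun x => `|f x|))//.
exact: measurableT_comp.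
Qed.

End Configurations.

(** * One-dimensional Gaussian integrals *)

Section GaussianIntegrals.
Variable R : realType.
Local Notation leb := (@lebesgue_measure R).
Local Notation phi := (@normal_pdf R 0 1).

Lemma normal_pdf01E (x : R) : phi x = normal_peak 1 * expR (- (x ^+ 2 / 2)).
Proof.
rewrite normal_pdfE ?oner_eq0// /normal_fun subr0 expr1n.
by rewrite mulNr.
Qed.

Lemma ge0_integral_gauss (f : R -> \bar R) : measurable_fun setT f ->
  (forall x, 0 <= f x)%E ->
  (\int[gauss R]_x f x = \int[leb]_x (f x * (phi x)%:E))%E.
Proof.
move=> mf f0.
have dom : gauss R `<< leb by exact: normal_prob_dominates.
rewrite -(Radon_Nikodym_SigmaFinite.change_of_variables dom f0 measurableT mf).
apply: ae_eq_integral => //.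
- apply: emeasurable_funM => //.
  exact: measurable_int (Radon_Nikodym_SigmaFinite.f_integrable dom).
- apply: emeasurable_funM => //; apply/measurable_EFinP.
  exact: measurable_normal_pdf.
apply: ae_eqe_mul2l; apply: integral_ae_eq => //.
- exact: Radon_Nikodym_SigmaFinite.f_integrable.
- by apply/measurable_EFinP; exact: measurable_normal_pdf.
- by move=> E _ mE; rewrite -Radon_Nikodym_SigmaFinite.f_integral.
Qed.

(** The ratio [expR (x ^+ 2 / 4)] of the two densities, up to a constant, absorbs
    any polynomial. *)
Lemma poly_normal_pdf_le p : exists2 C : R, 0 <= C &
  forall x, (1 + x ^+ 2) ^+ p * phi x <= C * normal_pdf 0 (Num.sqrt 2) x.
Proof.
have s2 : Num.sqrt 2 != 0 :> R by rewrite gt_eqF// sqrtr_gt0.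
pose q : R := (4 * p.+1)%:R.
have q0 : 0 < q by rewrite ltr0n.
have q1 : 1 <= q by rewrite ler1n.
exists (q ^+ p.+1 * normal_peak 1 / normal_peak (Num.sqrt 2)).
  by rewrite !mulr_ge0 ?invr_ge0 ?normal_peak_ge0// exprn_ge0// ltW.
move=> x; rewrite normal_pdf01E (normal_pdfE _ s2) /normal_fun subr0 sqr_sqrtr//.
have pk : normal_peak (Num.sqrt 2) != 0 :> R by rewrite gt_eqF// normal_peak_gt0.
rewrite -mulrA mulKf// mulrCA -mulrA [leRHS]mulrCA ler_wpM2l ?normal_peak_ge0//.
have -> : (- x ^+ 2 / (2 *+ 2) : R) = (x ^+ 2 / q) *+ p.+1 + - (x ^+ 2 / 2).
  by rewrite -mulr_natr /q natrM; field; rewrite addrC natr1.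
rewrite expRD -(mulr_natl (x ^+ 2 / q)) expRM_natl mulrA ler_wpM2r ?expR_ge0// -exprMn.
have x1 : 1 <= 1 + x ^+ 2 by rewrite lerDl sqr_ge0.
apply: le_trans (_ : (1 + x ^+ 2) ^+ p.+1 <= _).
  by rewrite ler_weXn2l.
rewrite lerXn2r ?nnegrE ?mulr_ge0 ?expR_ge0 ?(ltW q0) ?(le_trans _ x1)//.
rewrite -ler_pdivrMl// (le_trans _ (expR_ge1Dx _))// mulrDr mulr1 [_^-1 * _]mulrC.
by rewrite lerD2r invf_le1.
Qed.

Lemma integrable_poly_normal_pdf p :
  leb.-integrable setT (fun x => ((1 + x ^+ 2) ^+ p * phi x)%:E).
Proof.
have [C C0 le_C] := poly_normal_pdf_le p.
have s2 : Num.sqrt 2 != 0 :> R by rewrite gt_eqF// sqrtr_gt0.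
apply: (le_integrable measurableT _ _
    (integrableZl measurableT C (integrable_normal_pdf 0 (Num.sqrt 2)))).
  apply/measurable_EFinP; apply: measurable_funM; last exact: measurable_normal_pdf.
  by apply: measurable_funX; apply: measurable_funD => //; exact: measurable_funX.
move=> x _ /=; rewrite lee_fin !ger0_norm ?mulr_ge0 ?normal_pdf_ge0//.
by rewrite exprn_ge0// addr_ge0// sqr_ge0.
Qed.

Lemma integrable_poly_gauss p :
  (gauss R).-integrable setT (fun x => ((1 + x ^+ 2) ^+ p)%:E).
Proof.
have mp : measurable_fun setT (fun x : R => ((1 + x ^+ 2) ^+ p)%:E).
  apply/measurable_EFinP; apply: measurable_funX.
  by apply: measurable_funD => //; exact: measurable_funX.
have p0 x : 0 <= (1 + x ^+ 2) ^+ p :> R by rewrite exprn_ge0// addr_ge0// sqr_ge0.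
apply/integrableP; split => //.
rewrite (ge0_integral_gauss (f := fun x => `|((1 + x ^+ 2) ^+ p)%:E|%E))//; last first.
  exact: measurableT_comp.
have /integrableP[_] := integrable_poly_normal_pdf p.
congr (_ < _)%E; apply: eq_integral => x _ /=.
by rewrite -EFinM normrM (ger0_norm (normal_pdf_ge0 _ _ _)).
Qed.

End GaussianIntegrals.

Section GaussianByParts.
Variable R : realType.
Local Notation leb := (@lebesgue_measure R).
Local Notation phi := (@normal_pdf R 0 1).

Lemma integral_gauss (f : R -> \bar R) : (gauss R).-integrable setT f ->
  (\int[gauss R]_x f x = \int[leb]_x (f x * (phi x)%:E))%E.
Proof.
move=> fi; have mf := measurable_int _ fi.
have dom : gauss R `<< leb by exact: normal_prob_dominates.
rewrite -(Radon_Nikodym_change_of_variables dom measurableT fi).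
apply: ae_eq_integral => //.
- exact: emeasurable_funM.
- apply: emeasurable_funM => //; apply/measurable_EFinP.
  exact: measurable_normal_pdf.
apply: ae_eqe_mul2l => /=; rewrite Radon_NikodymE//=.
case: cid => /= g [g1 g2 g3]; apply: integral_ae_eq => //=.
- by apply/measurable_EFinP; exact: measurable_normal_pdf.
- by move=> E _ mE; rewrite -g3.
Qed.

Lemma is_derive_normal_pdf (x : R) : is_derive x 1 phi (- x * phi x).
Proof.
rewrite (_ : phi = fun y => normal_peak 1 * expR (- (y ^+ 2 / 2))); last first.
  by apply/funext => y; exact: normal_pdf01E.
apply: is_derive_eq => /=.
by rewrite !scaler1 /GRing.scale /=; field.
Qed.

Variables (h h' : R -> R) (c : R) (p : nat).
Hypothesis dh : forall x : R, is_derive x 1 h (h' x).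
Hypothesis ch' : continuous h'.
Hypothesis hc : forall x, `|h x| <= c * (1 + x ^+ 2) ^+ p.
Hypothesis h'c : forall x, `|h' x| <= c * (1 + x ^+ 2) ^+ p.

Let c0 : 0 <= c.
Proof. by have := le_trans (normr_ge0 _) (hc 0); rewrite expr0n addr0 expr1n mulr1. Qed.

Let k x := h x * phi x.
Let g x := h' x - x * h x.

Let ch : continuous h.
Proof. by move=> x; apply/differentiable_continuous/derivable1_diffP; case: (dh x). Qed.

Let cg : continuous g.
Proof.
by move=> x; apply: cvgB; [exact: ch'|apply: cvgM; [exact: cvg_id|exact: ch]].
Qed.

Let cphi : continuous phi.
Proof. by apply: continuous_normal_pdf; rewrite oner_eq0. Qed.

Let g_le x : `|g x| <= 2 * c * (1 + x ^+ 2) ^+ p.+1.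
Proof.
have x1 : 1 <= 1 + x ^+ 2 by rewrite lerDl sqr_ge0.
have xx : `|x| <= 1 + x ^+ 2.
  by rewrite -[x ^+ 2]real_normK ?num_real//; set y := `|x|; nra.
rewrite /g (le_trans (ler_normB _ _))// normrM -mulrA mulr_natl mulr2n lerD//.
  by rewrite (le_trans (h'c x))// ler_wpM2l// ler_weXn2l.
by rewrite exprS mulrCA ler_pM.
Qed.

Lemma gauss_by_parts_integrable :
  (gauss R).-integrable setT (fun x => (h' x - x * h x)%:E).
Proof.
apply: (le_integrable measurableT _ _
  (integrableZl measurableT (2 * c) (integrable_poly_gauss R p.+1))).
  by apply/measurable_EFinP; exact: continuous_measurable_fun.
by move=> x _ /=; rewrite lee_fin (le_trans (g_le x))// ler_norm.
Qed.

Let gphi_le x : `|g x * phi x| <= 2 * c * ((1 + x ^+ 2) ^+ p.+1 * phi x).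
Proof.
rewrite normrM (ger0_norm (normal_pdf_ge0 _ _ _)) mulrA ler_wpM2r//.
exact: normal_pdf_ge0.
Qed.

Let dk (x : R) : is_derive x 1 k (g x * phi x).
Proof.
apply: (is_derive_eq (is_deriveM (dh x) (is_derive_normal_pdf x))).
by rewrite /g /GRing.scale /=; ring.
Qed.

Let k_le : exists2 C, 0 <= C & forall x, `|k x| <= C / (1 + x ^+ 2).
Proof.
have [C C0 hC] := poly_normal_pdf_le R p.+1.
exists (c * C * normal_peak (Num.sqrt 2)); first by rewrite !mulr_ge0 ?normal_peak_ge0.
move=> x; have x1 : 0 < 1 + x ^+ 2 by rewrite ltr_pwDl// sqr_ge0.
rewrite ler_pdivlMr// normrM (ger0_norm (normal_pdf_ge0 _ _ _)).
rewrite -!mulrA (le_trans (ler_wpM2r _ (hc x)))//.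
  by rewrite mulr_ge0 ?normal_pdf_ge0// ltW.
rewrite -!mulrA ler_wpM2l// mulrCA mulrC -exprSr.
by rewrite (le_trans (hC x))// ler_wpM2l// normal_pdf_ub// gt_eqF// sqrtr_gt0.
Qed.

(** The integrand times the density is the derivative of [h * phi], which
    vanishes at infinity. *)
Lemma gauss_by_parts : (\int[gauss R]_x (h' x - x * h x)%:E = 0)%E.
Proof.
rewrite (integral_gauss gauss_by_parts_integrable) /=.
pose f (n : nat) := (fun x => (g x * phi x)%:E) \_ `[- n%:R, n%:R].
have mgphi : measurable_fun setT (fun x => (g x * phi x)%:E).
  apply/measurable_EFinP; apply: measurable_funM; last exact: measurable_normal_pdf.
  exact: continuous_measurable_fun.
have iB : leb.-integrable setT
    (fun x => (2 * c * ((1 + x ^+ 2) ^+ p.+1 * phi x))%:E).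
  exact: (integrableZl measurableT (2 * c) (integrable_poly_normal_pdf R p.+1)).
have [] := @dominated_convergence _ _ _ leb setT measurableT f
  (fun x => (g x * phi x)%:E) _ _ mgphi _ iB.
- by move=> n; apply/measurable_restrict => //; rewrite setTI; exact: measurable_funTS.
- apply: aeW => x _; apply: cvg_near_cst; near=> n.
  rewrite /f patchE mem_set//= in_itv/= -ler_norml.
  by near: n; exact: nbhs_infty_ger.
- apply: aeW => x n _; rewrite /f patchE; case: ifP => _ /=.
    by rewrite lee_fin gphi_le.
  by rewrite normr0 lee_fin (le_trans (normr_ge0 _) (gphi_le x)).
move=> _ _ cv.
have FTC n : (\int[leb]_x f n.+1 x = (k n.+1%:R - k (- n.+1%:R))%:E)%E.
  rewrite /f -integral_mkcond.
  have lt n' : (- n'.+1%:R < n'.+1%:R :> R)%R by rewrite gtrN.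
  rewrite (continuous_FTC2 (lt n) (F := k)) => [//|||].
  - apply: continuous_subspaceT => x; apply: cvgM; [exact: cg|exact: cphi].
  - have ck : continuous k by move=> x; apply: cvgM; [exact: ch|exact: cphi].
    split; first by move=> x _; case: (dk x).
    + by apply: cvg_at_right_filter; exact: ck.
    + by apply: cvg_at_left_filter; exact: ck.
  - by move=> x _; rewrite derive1E; case: (dk x).
have [C C0 kC] := k_le.
have lim0 : (k n.+1%:R - k (- n.+1%:R)) @[n --> \oo] --> (0 : R).
  have kn (n : nat) : `|k n.+1%:R - k (- n.+1%:R)| <= 2 * C * n.+1%:R^-1.
    have le1 : C / (1 + n.+1%:R ^+ 2) <= C / n.+1%:R.
      have n1 : 1 <= n.+1%:R :> R by rewrite ler1n.
      by rewrite ler_wpM2l// lef_pV2 ?posrE; nra.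
    rewrite (le_trans (ler_normB _ _))// -mulrA mulr_natl mulr2n.
    by rewrite lerD// (le_trans (kC _))// ?sqrrN.
  have lc (b : R) : b * n.+1%:R^-1 @[n --> \oo] --> (0 : R).
    rewrite -[X in _ --> X](mulr0 b); apply: cvgM; first exact: cvg_cst.
    exact: cvg_harmonic.
  apply: (@squeeze_cvgr _ _ _ _ (fun n => - (2 * C) * n.+1%:R^-1)
            (fun n => 2 * C * n.+1%:R^-1)) => //.
  by apply: nearW => n; rewrite mulNr -ler_norml.
have cv0 : (\int[leb]_x f n.+1 x)%E @[n --> \oo] --> 0%:E.
  under eq_cvg do rewrite FTC.
  by apply: cvg_EFin => //; exact: nearW.
have cv' : (\int[leb]_x f n.+1 x)%E @[n --> \oo] --> (\int[leb]_x (g x * phi x)%:E)%E.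
  by move: cv; rewrite -(cvg_shiftS (fun n => \int[leb]_x f n x)%E).
exact: (cvg_unique _ cv' cv0).
Unshelve. all: by end_near. Qed.

End GaussianByParts.

(** * Gaussian integration by parts in several variables *)

Lemma exprD_le (R : realType) (a b : R) p : 0 <= a -> 0 <= b ->
  (a + b) ^+ p <= 2 ^+ p * (a ^+ p + b ^+ p).
Proof.
wlog ab : a b / a <= b => [H a0 b0|a0 b0].
  have [/H|/ltW/H] := leP a b; first exact.
  by rewrite addrC [a ^+ p + _]addrC; exact.
apply: (@le_trans _ _ ((2 * b) ^+ p)).
  by rewrite lerXn2r ?nnegrE ?addr_ge0 ?mulr_ge0// mulr_natl mulr2n lerD2r.
by rewrite exprMn ler_wpM2l ?exprn_ge0// lerDr exprn_ge0.
Qed.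

(** Bounds a power of a sum by powers of single terms, so that the integrability
    of polynomials in several coordinates follows from that in each one. *)
Lemma expr_sum_le (R : realType) (I : Type) (r : seq I) (y : I -> R) p :
  (forall i, 0 <= y i) ->
  (1 + \sum_(i <- r) y i) ^+ p <=
  (2 ^+ p) ^+ size r * (1 + \sum_(i <- r) y i ^+ p).
Proof.
move=> y0; elim: r => [|i r IH] /=.
  by rewrite !big_nil !addr0 expr0 mul1r expr1n.
rewrite !big_cons exprS -mulrA addrCA.
have S0 : 0 <= \sum_(j <- r) y j by exact: sumr_ge0.
rewrite (le_trans (exprD_le _ _ _))// ?addr_ge0//.
rewrite ler_wpM2l ?exprn_ge0// addrCA mulrDr lerD//.
rewrite ler_peMl ?exprn_ge0// exprn_ege1// exprn_ege1//.
by rewrite ler1n.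
Qed.

Section Tame.
Variables (R : realType) (I : finType).
Local Notation config := (config R I).
Implicit Types (f g : config -> R) (t : I).

Definition csize (c : config) : R := 1 + \sum_i c i ^+ 2.

(** Polynomial growth gives integrability under the Gaussian law together with
    the bounds along coordinate lines that integration by parts requires, and
    is preserved by sums and products. *)
Definition tame f := measurable_fun setT f /\
  exists C p, forall c, `|f c| <= C * csize c ^+ p.

Lemma csize_ge1 c : 1 <= csize c.
Proof. by rewrite lerDl sumr_ge0// => i _; exact: sqr_ge0. Qed.

Let csize_ge0 c : 0 <= csize c.
Proof. exact: le_trans (csize_ge1 c). Qed.

Lemma tame_bound_ge0 f C p : (forall c, `|f c| <= C * csize c ^+ p) -> 0 <= C.
Proof.
move=> /(_ (fun=> 0)) /(le_trans (normr_ge0 _)).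
by rewrite pmulr_lge0// exprn_gt0// (lt_le_trans ltr01) ?csize_ge1.
Qed.

Lemma tame_bounded f C : measurable_fun setT f -> (forall c, `|f c| <= C) ->
  tame f.
Proof. by move=> mf fC; split => //; exists C, 0%N => c; rewrite expr0 mulr1. Qed.

Lemma tame_cst (a : R) : tame (fun=> a).
Proof. exact: (@tame_bounded _ `|a|). Qed.

Lemma tame_coord t : tame (fun c => c t).
Proof.
split; first exact: measurable_coord.
exists 1, 1%N => c; rewrite mul1r expr1 /csize (bigD1 t)//=.
have S0 : 0 <= \sum_(i | i != t) c i ^+ 2 by rewrite sumr_ge0// => i _; exact: sqr_ge0.
have := real_normK (num_real (c t)).
set y := `|c t|; move: S0; set S := \sum_(_ | _) _ => S0 <-.
by nra.
Qed.

Lemma tameD f g : tame f -> tame g -> tame (fun c => f c + g c).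
Proof.
move=> [mf [C1 [p1 h1]]] [mg [C2 [p2 h2]]]; split; first exact: measurable_funD.
have C10 := tame_bound_ge0 h1; have C20 := tame_bound_ge0 h2.
exists (C1 + C2), (p1 + p2)%N => c; rewrite (le_trans (ler_normD _ _))// mulrDl.
have c1 := csize_ge1 c.
rewrite lerD// (le_trans (h1 c), le_trans (h2 c))// ler_wpM2l// ler_weXn2l//.
  exact: leq_addr.
exact: leq_addl.
Qed.

Lemma tameM f g : tame f -> tame g -> tame (fun c => f c * g c).
Proof.
move=> [mf [C1 [p1 h1]]] [mg [C2 [p2 h2]]]; split; first exact: measurable_funM.
exists (C1 * C2), (p1 + p2)%N => c; rewrite normrM exprD mulrACA.
by rewrite ler_pM.
Qed.

Lemma tameZ a f : tame f -> tame (fun c => a * f c).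
Proof. exact/tameM/tame_cst. Qed.

Lemma tameN f : tame f -> tame (fun c => - f c).
Proof. by move=> /(tameZ (-1)); under eq_fun do rewrite mulN1r. Qed.

Lemma tameB f g : tame f -> tame g -> tame (fun c => f c - g c).
Proof. by move=> tf /tameN; exact: tameD. Qed.

Lemma tame_sum J (r : seq J) (P : pred J) (F : J -> config -> R) :
  (forall j, tame (F j)) -> tame (fun c => \sum_(j <- r | P j) F j c).
Proof.
move=> tF; elim: r => [|j r IH].
  by under eq_fun do rewrite big_nil; exact: tame_cst.
under eq_fun do rewrite big_cons.
by case: (P j) => //; exact: tameD.
Qed.

Variable mu : probability config R.
Hypothesis mu_gauss : gaussian_law mu.

Lemma tame_integrable f : tame f -> mu.-integrable setT (EFin \o f).
Proof.
move=> [mf [C [p fC]]]; have C0 := tame_bound_ge0 fC.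
pose q (c : config) i := (1 + c i ^+ 2) ^+ p.
have mq i : measurable_fun setT (fun c => (q c i)%:E).
  apply/measurable_EFinP; apply: measurable_funX; apply: measurable_funD => //.
  by apply: measurable_funX; exact: measurable_coord.
have q0 c i : 0 <= q c i by rewrite exprn_ge0// addr_ge0// sqr_ge0.
have iq i : mu.-integrable setT (fun c => (q c i)%:E).
  apply/integrableP; split => //.
  have /integrableP[mp] := @integrable_poly_gauss R p.
  rewrite -(ge0_integral_coord mu_gauss i)//; exact: measurableT_comp.
have iS : mu.-integrable setT (fun c => (1 + \sum_i q c i)%:E).
  rewrite (_ : (fun c => (_)%:E) = fun c => (1%:E + \sum_i (q c i)%:E)%E).
    2: by apply/funext => c; rewrite EFinD sumEFin.
  apply: integrableD => //.
    by apply: finite_measure_integrable_cst.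
  by apply: integrable_sum => // i _; exact: iq.
apply: (le_integrable measurableT _ _ (integrableZl measurableT
  (C * (2 ^+ p) ^+ size (index_enum I)) iS)); first exact/measurable_EFinP.
move=> c _ /=; rewrite lee_fin (le_trans (fC c))// (le_trans _ (ler_norm _))//.
rewrite -mulrA ler_wpM2l// (le_trans _ (expr_sum_le _ _ _))//; last first.
  by move=> i; rewrite addr_ge0// sqr_ge0.
rewrite lerXn2r ?nnegrE ?csize_ge0//.
  by rewrite addr_ge0// sumr_ge0// => i _; rewrite addr_ge0// sqr_ge0.
by rewrite lerD2l ler_sum// => i _; rewrite lerDr.
Qed.

Definition expect f : R := \int[mu]_c f c.

Lemma expectD f g : tame f -> tame g ->
  expect (fun c => f c + g c) = expect f + expect g.
Proof. by move=> tf tg; rewrite /expect RintegralD//; exact: tame_integrable. Qed.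

Lemma expectZ a f : tame f -> expect (fun c => a * f c) = a * expect f.
Proof. by move=> tf; rewrite /expect RintegralZl//; exact: tame_integrable. Qed.

Lemma expectB f g : tame f -> tame g ->
  expect (fun c => f c - g c) = expect f - expect g.
Proof. by move=> tf tg; rewrite /expect RintegralB//; exact: tame_integrable. Qed.

Lemma expect_cst a : expect (fun=> a) = a.
Proof.
have mu1 : mu setT = 1%E by exact: probability_setT.
rewrite /expect Rintegral_cst// -[RHS]mulr1; congr (_ * _).
exact: (congr1 fine mu1).
Qed.

Lemma expect_sum J (r : seq J) (P : pred J) (F : J -> config -> R) :
  (forall j, tame (F j)) ->
  expect (fun c => \sum_(j <- r | P j) F j c) = \sum_(j <- r | P j) expect (F j).
Proof.
move=> tF; elim: r => [|j r IH].
  rewrite big_nil -[RHS](expect_cst 0); congr expect.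
  by apply/funext => c; rewrite big_nil.
rewrite big_cons; under [in LHS]eq_fun do rewrite big_cons.
case: (P j) => //; rewrite expectD// ?IH//; exact: tame_sum.
Qed.

Lemma le_expect f g : tame f -> tame g -> (forall c, f c <= g c) ->
  expect f <= expect g.
Proof.
by move=> tf tg fg; apply: le_Rintegral => //; exact: tame_integrable.
Qed.

Lemma expectE f : tame f -> (\int[mu]_c (f c)%:E)%E = (expect f)%:E.
Proof.
move=> tf; rewrite /expect /Rintegral fineK//.
exact/integrable_fin_num/tame_integrable.
Qed.

Definition upd (c : config) t (x : R) : config :=
  fun i => if i == t then x else c i.

(** Partial differentiability with the side conditions of integration by parts,
    bundled so that they propagate through sums and products together. *)
Definition pderiv t f f' := [/\ tame f, tame f',
  forall c (x : R), is_derive x 1 (fun y => f (upd c t y)) (f' (upd c t x)) &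
  forall c, continuous (fun y => f' (upd c t y))].

Lemma pderiv_continuous t f f' c :
  pderiv t f f' -> continuous (fun y => f (upd c t y)).
Proof.
by move=> [_ _ df _] x; apply/differentiable_continuous/derivable1_diffP; case: (df c x).
Qed.

Lemma pderiv_cst t a : pderiv t (fun=> a) (fun=> 0).
Proof.
split; [exact: tame_cst|exact: tame_cst|move=> *; exact: is_derive_cst|].
by move=> ? ?; exact: cvg_cst.
Qed.

Lemma pderiv_coord t i : pderiv t (fun c => c i) (fun=> (i == t)%:R).
Proof.
split; [exact: tame_coord|exact: tame_cst| |by move=> ? ?; exact: cvg_cst].
by move=> c x; rewrite /upd; case: eqP => _; [exact: is_derive_id|exact: is_derive_cst].
Qed.

Lemma pderivD t f f' g g' : pderiv t f f' -> pderiv t g g' ->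
  pderiv t (fun c => f c + g c) (fun c => f' c + g' c).
Proof.
move=> [tf tf' df cf] [tg tg' dg cg]; split; [exact: tameD|exact: tameD| |].
  by move=> c x; exact: (is_deriveD (df c x) (dg c x)).
by move=> c x; exact: (cvgD (cf c x) (cg c x)).
Qed.

Lemma pderivM t f f' g g' : pderiv t f f' -> pderiv t g g' ->
  pderiv t (fun c => f c * g c) (fun c => f' c * g c + f c * g' c).
Proof.
move=> pf pg; have [tf tf' df cf] := pf; have [tg tg' dg cg] := pg.
split; [exact: tameM|by apply: tameD; exact: tameM| |].
  move=> c x; apply: (is_derive_eq (is_deriveM (df c x) (dg c x))).
  by rewrite /GRing.scale /=; ring.
move=> c x; apply: cvgD; apply: cvgM.
- exact: cf.
- exact: (pderiv_continuous pg).
- exact: (pderiv_continuous pf).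
- exact: cg.
Qed.

Lemma pderiv_sum t J (r : seq J) (F F' : J -> config -> R) :
  (forall j, pderiv t (F j) (F' j)) ->
  pderiv t (fun c => \sum_(j <- r) F j c) (fun c => \sum_(j <- r) F' j c).
Proof.
move=> dF; elim: r => [|j r IH].
  under eq_fun do rewrite big_nil; under [X in pderiv _ _ X]eq_fun do rewrite big_nil.
  exact: pderiv_cst.
under eq_fun do rewrite big_cons; under [X in pderiv _ _ X]eq_fun do rewrite big_cons.
exact: pderivD.
Qed.

Let csize_upd c t x : csize (upd c t x) <= csize c * (1 + x ^+ 2).
Proof.
rewrite /csize [in leLHS](bigD1 t)//= [in leRHS](bigD1 t)//= {1}/upd eqxx.
rewrite (eq_bigr (fun i => c i ^+ 2)) => [|i it]; last by rewrite /upd (negbTE it).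
have S0 : 0 <= \sum_(i | i != t) c i ^+ 2 by rewrite sumr_ge0// => i _; exact: sqr_ge0.
have := sqr_ge0 x; have := sqr_ge0 (c t); move: S0.
set S := \sum_(_ | _) _; set u := c t ^+ 2; set v := x ^+ 2 => S0 u0 v0.
rewrite -subr_ge0.
have -> : (1 + (u + S)) * (1 + v) - (1 + (v + S)) = u + v * (u + S) by ring.
by rewrite addr_ge0// mulr_ge0// addr_ge0.
Qed.

(** Redrawing only the coordinate [t] leaves a one-dimensional Gaussian integral
    along a line, which vanishes by [gauss_by_parts]. *)
Lemma stein t f f' : pderiv t f f' ->
  expect (fun c => c t * f c) = expect f'.
Proof.
move=> [tf tf' df cf'].
have tg : tame (fun c => f' c - c t * f c).
  by apply: tameB => //; apply: tameM => //; exact: tame_coord.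
apply/eqP; rewrite eq_sym -subr_eq0 -expectB//; last first.
  by apply: tameM => //; exact: tame_coord.
apply/eqP/EFin_inj; rewrite -expectE//.
rewrite (integral_mix mu_gauss (pred1 t) (tame_integrable tg)).
rewrite (_ : (fun c => _) = cst 0%E) ?integral0//.
apply/funext => c /=.
have [mf [C1 [p1 h1]]] := tf; have [mf' [C2 [p2 h2]]] := tf'.
have C10 := tame_bound_ge0 h1; have C20 := tame_bound_ge0 h2.
pose C := (C1 + C2) * csize c ^+ (p1 + p2).
have bnd (F : config -> R) C0 p : 0 <= C0 -> C0 <= C1 + C2 ->
    (p <= p1 + p2)%N ->
    (forall c, `|F c| <= C0 * csize c ^+ p) ->
    forall x, `|F (upd c t x)| <= C * (1 + x ^+ 2) ^+ (p1 + p2).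
  move=> C00 C0C pp hF x; rewrite /C -mulrA -exprMn (le_trans (hF _))//.
  rewrite ler_pM// ?exprn_ge0// (le_trans (ler_weXn2l _ pp)) ?csize_ge1//.
  by rewrite lerXn2r ?nnegrE ?csize_upd ?mulr_ge0// ?addr_ge0 ?sqr_ge0.
have b1 := bnd f C1 p1 C10; have b2 := bnd f' C2 p2 C20.
rewrite lerDl C20 leq_addr in b1; rewrite lerDr C10 leq_addl in b2.
have bp := gauss_by_parts (df c) (cf' c) (b1 isT isT h1) (b2 isT isT h2).
have ip := gauss_by_parts_integrable (df c) (cf' c) (b1 isT isT h1) (b2 isT isT h2).
rewrite -[RHS]bp -(integral_coord mu_gauss t ip).
apply: eq_integral => c' _.
rewrite (_ : mix _ c c' = upd c t (c' t)); last first.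
  by apply/funext => i; rewrite /mix /upd /=; case: eqP => [->|].
by rewrite {2}/upd eqxx.
Qed.

End Tame.

(** * Measurability and derivatives of matrix-valued functions *)

Lemma eq_fun_cvg (U : Type) (V : topologicalType) (D : set_system U)
    (f g : U -> V) (a : V) : f =1 g -> g x @[x --> D] --> a -> f x @[x --> D] --> a.
Proof. by move=> /funext ->. Qed.

(** The continuous functions [x / (x ^+ 2 + 1 / (k + 1))] converge to the inverse
    everywhere, also at [0] where [0^-1 = 0]. *)
Lemma measurable_inv (R : realType) : measurable_fun setT (fun x : R => x^-1).
Proof.
pose h (k : nat) (x : R) := x / (x ^+ 2 + k.+1%:R^-1).
have e0 (k : nat) : 0 < k.+1%:R^-1 :> R by rewrite invr_gt0.
have pos k (x : R) : 0 < x ^+ 2 + k.+1%:R^-1 by rewrite ltr_wpDl// sqr_ge0.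
apply: (measurable_fun_cvg (h := h)) => [k|x _].
  apply: continuous_measurable_fun => x; apply: cvgM; first exact: cvg_id.
  apply: cvgV; first by rewrite gt_eqF.
  by apply: cvgD; [exact: exprn_continuous|exact: cvg_cst].
have [->|x0] := eqVneq x 0.
  by rewrite /h invr0; under eq_fun do rewrite mul0r; exact: cvg_cst.
rewrite [X in _ --> X](_ : _ = x / (x ^+ 2 + 0)).
  apply: cvgM; first exact: cvg_cst.
  apply: cvgV; first by rewrite addr0 sqrf_eq0.
  by apply: cvgD; [exact: cvg_cst|exact: cvg_harmonic].
by rewrite addr0 expr2 invfM mulrA divff// mul1r.
Qed.

Section MeasurableMatrix.
Context (R : realType) d (T : measurableType d).

Definition measurable_mx p q (F : T -> 'M[R]_(p, q)) :=
  forall i j, measurable_fun setT (fun w => F w i j).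

Lemma measurable_mx_cst p q (X : 'M[R]_(p, q)) : measurable_mx (fun=> X).
Proof. by move=> i j; exact: measurable_cst. Qed.

Lemma measurable_mxD p q (F G : T -> 'M[R]_(p, q)) :
  measurable_mx F -> measurable_mx G -> measurable_mx (fun w => F w + G w).
Proof.
by move=> mF mG i j; under eq_fun do rewrite mxE; exact: measurable_funD.
Qed.

Lemma measurable_mxB p q (F G : T -> 'M[R]_(p, q)) :
  measurable_mx F -> measurable_mx G -> measurable_mx (fun w => F w - G w).
Proof.
by move=> mF mG i j; under eq_fun do rewrite !mxE; exact: measurable_funB.
Qed.

Lemma measurable_mxT p q (F : T -> 'M[R]_(p, q)) :
  measurable_mx F -> measurable_mx (fun w => (F w)^T).
Proof. by move=> mF i j; under eq_fun do rewrite mxE; exact: mF. Qed.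

Lemma measurable_mxM p q r (F : T -> 'M[R]_(p, q)) (G : T -> 'M[R]_(q, r)) :
  measurable_mx F -> measurable_mx G -> measurable_mx (fun w => F w *m G w).
Proof.
move=> mF mG i j; under eq_fun do rewrite mxE.
by apply: measurable_sum => k; exact: measurable_funM.
Qed.

Lemma measurable_mxZ p q (f : T -> R) (F : T -> 'M[R]_(p, q)) :
  measurable_fun setT f -> measurable_mx F -> measurable_mx (fun w => f w *: F w).
Proof.
by move=> mf mF i j; under eq_fun do rewrite mxE; exact: measurable_funM.
Qed.

Lemma measurable_mx_col p q (F : T -> 'M[R]_(p, q)) j :
  measurable_mx F -> measurable_mx (fun w => col j (F w)).
Proof. by move=> mF a b; under eq_fun do rewrite mxE; exact: mF. Qed.

Lemma measurable_mdot p q (F G : T -> 'M[R]_(p, q)) :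
  measurable_mx F -> measurable_mx G -> measurable_fun setT (fun w => mdot (F w) (G w)).
Proof.
move=> mF mG; rewrite (_ : (fun w => _) = fun w => \tr ((F w)^T *m G w))//.
apply: measurable_sum => i; apply: measurable_mxM => //; exact: measurable_mxT.
Qed.

Lemma measurable_mxtrace p (F : T -> 'M[R]_p) :
  measurable_mx F -> measurable_fun setT (fun w => \tr (F w)).
Proof. by move=> mF; apply: measurable_sum => i; exact: mF. Qed.

Lemma measurable_msq p q (F : T -> 'M[R]_(p, q)) :
  measurable_mx F -> measurable_fun setT (fun w => msq (F w)).
Proof.
by move=> mF; apply/measurable_mxtrace/measurable_mxM => //; exact: measurable_mxT.
Qed.

Lemma measurable_det p (F : T -> 'M[R]_p) :
  measurable_mx F -> measurable_fun setT (fun w => \det (F w)).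
Proof.
move=> mF; rewrite /determinant; apply: measurable_sum => s.
by apply: measurable_funM => //; apply: measurable_prod => i _; exact: mF.
Qed.

Lemma measurable_invmx p (F : T -> 'M[R]_p) : (forall w, F w \in unitmx) ->
  measurable_mx F -> measurable_mx (fun w => invmx (F w)).
Proof.
move=> uF mF i j.
rewrite (_ : (fun w => _) = (fun w => (\det (F w))^-1 * \adj (F w) i j)).
  2: by apply/funext => w; rewrite /invmx uF mxE.
apply: measurable_funM.
  exact: measurableT_comp (@measurable_inv R) (measurable_det mF).
under eq_fun do rewrite mxE /cofactor.
apply: measurable_funM => //; apply: measurable_det => a b.
by under eq_fun do rewrite !mxE; exact: mF.
Qed.

Lemma measurable_regK p q (F : T -> 'M[R]_(p, q)) l : 0 < l ->
  measurable_mx F -> measurable_mx (fun w => regK (F w) l).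
Proof.
move=> l0 mF; apply: measurable_invmx => [w|]; first exact: regN_unit.
apply: measurable_mxD; last exact: measurable_mx_cst.
by apply: measurable_mxM => //; exact: measurable_mxT.
Qed.

Lemma measurable_moore_penrose p q (F : T -> 'M[R]_(p, q)) :
  measurable_mx F -> measurable_mx (fun w => moore_penrose (F w)).
Proof.
move=> mF i j.
apply: (measurable_fun_cvg
  (h := fun k w => ((F w)^T *m regK (F w) k.+1%:R^-1) i j)) => [k|w _].
  by apply: measurable_mxM; [exact: measurable_mxT|exact: measurable_regK].
exact: cvg_regK_pinv.
Qed.

End MeasurableMatrix.

Section MatrixDerivative.
Variables (R : realType) (I : finType).
Local Notation config := (config R I).

Definition pderiv_mx p q (t : I) (F F' : config -> 'M[R]_(p, q)) :=
  forall i j, pderiv t (fun c => F c i j) (fun c => F' c i j).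

Lemma pderiv_mx_cst p q t (X : 'M[R]_(p, q)) : pderiv_mx t (fun=> X) (fun=> 0).
Proof.
move=> i j; under [X in pderiv _ _ X]eq_fun do rewrite mxE.
exact: pderiv_cst.
Qed.

Lemma pderiv_mxD p q t (F F' G G' : config -> 'M[R]_(p, q)) :
  pderiv_mx t F F' -> pderiv_mx t G G' ->
  pderiv_mx t (fun c => F c + G c) (fun c => F' c + G' c).
Proof.
move=> dF dG i j; under [X in pderiv _ X]eq_fun do rewrite mxE.
by under [X in pderiv _ _ X]eq_fun do rewrite mxE; exact: pderivD.
Qed.

Lemma pderiv_mxT p q t (F F' : config -> 'M[R]_(p, q)) :
  pderiv_mx t F F' -> pderiv_mx t (fun c => (F c)^T) (fun c => (F' c)^T).
Proof.
move=> dF i j; under [X in pderiv _ X]eq_fun do rewrite mxE.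
by under [X in pderiv _ _ X]eq_fun do rewrite mxE; exact: dF.
Qed.

Lemma pderiv_mxM p q r t (F F' : config -> 'M[R]_(p, q))
    (G G' : config -> 'M[R]_(q, r)) :
  pderiv_mx t F F' -> pderiv_mx t G G' ->
  pderiv_mx t (fun c => F c *m G c) (fun c => F' c *m G c + F c *m G' c).
Proof.
move=> dF dG i j; under [X in pderiv _ X]eq_fun do rewrite mxE.
under [X in pderiv _ _ X]eq_fun do rewrite !mxE -big_split /=.
by apply: pderiv_sum => k; exact: pderivM.
Qed.

Lemma tame_mxM p q r (F : config -> 'M[R]_(p, q)) (G : config -> 'M[R]_(q, r)) :
  (forall i j, tame (fun c => F c i j)) -> (forall i j, tame (fun c => G c i j)) ->
  forall i j, tame (fun c => (F c *m G c) i j).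
Proof.
move=> tF tG i j; under eq_fun do rewrite mxE.
by apply: tame_sum => k; exact: tameM.
Qed.

Lemma tame_mxtrace p (F : config -> 'M[R]_p) :
  (forall i j, tame (fun c => F c i j)) -> tame (fun c => \tr (F c)).
Proof. by move=> tF; apply: tame_sum. Qed.

(** The resolvent identity [K x - K y = - K x (N x - N y) K y] gives first the
    continuity of the inverse, [K] being bounded, then its derivative. *)
Lemma pderiv_inv p t (N N' K : config -> 'M[R]_p) (C : R) :
  pderiv_mx t N N' -> (forall c, N c *m K c = 1%:M) ->
  (forall c, K c *m N c = 1%:M) ->
  measurable_mx K -> (forall c i j, `|K c i j| <= C) ->
  pderiv_mx t K (fun c => - (K c *m N' c *m K c)).
Proof.
move=> dN NK KN mK KC.
have C0 (c : config) (i j : 'I_p) : 0 <= C by exact: le_trans (normr_ge0 _) (KC c i j).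
have tK i j : tame (fun c => K c i j) by exact: tame_bounded.
have resolvent (x y : config) : K x - K y = - (K x *m (N x - N y) *m K y).
  by rewrite mulmxBr KN mulmxBl mul1mx -mulmxA NK mulmx1 opprB.
have cK (c : config) (x : R) i j : K (upd c t y) i j @[y --> x] --> K (upd c t x) i j.
  have dK y : K (upd c t y) i j = K (upd c t x) i j -
      (K (upd c t y) *m (N (upd c t y) - N (upd c t x)) *m K (upd c t x)) i j.
    have /matrixP/(_ i j) := resolvent (upd c t y) (upd c t x).
    by rewrite !mxE => /eqP; rewrite subr_eq addrC => /eqP.
  rewrite (_ : (fun y => K (upd c t y) i j) = fun y => K (upd c t x) i j -
      (K (upd c t y) *m (N (upd c t y) - N (upd c t x)) *m K (upd c t x)) i j);
    last exact/funext/dK.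
  rewrite -[X in _ --> X]subr0; apply: cvgB; first exact: cvg_cst.
  rewrite [X in _ --> X](_ : 0 = ((0 : 'M[R]_p) *m K (upd c t x)) i j); last first.
    by rewrite mul0mx mxE.
  apply: cvg_entry_mulmx => [a b|a b]; last exact: cvg_cst.
  apply: (eq_fun_cvg (g := fun y =>
    \sum_k K (upd c t y) a k * (N (upd c t y) - N (upd c t x)) k b)).
    by move=> y; rewrite mxE.
  rewrite [X in _ --> X](_ : _ = \sum_(k < p) 0); last by rewrite mxE big1.
  apply: cvg_big => [|k _]; first exact: add_continuous.
  have cN : (N (upd c t y) - N (upd c t x)) k b @[y --> x] --> 0.
    apply: (eq_fun_cvg (g := fun y => N (upd c t y) k b - N (upd c t x) k b)).
      by move=> y; rewrite !mxE.
    rewrite -[X in _ --> X](subrr (N (upd c t x) k b)); apply: cvgB; last exact: cvg_cst.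
    exact: (pderiv_continuous (dN k b)).
  apply/norm_cvg0P; apply: (@squeeze_cvgr _ _ _ _ (fun=> 0)
    (fun y => C * `|(N (upd c t y) - N (upd c t x)) k b|)).
  - by apply: nearW => y; rewrite normr_ge0 /= normrM; apply: ler_wpM2r => //; exact: KC.
  - exact: cvg_cst.
  - rewrite -[X in _ --> X](mulr0 C); apply: cvgM; first exact: cvg_cst.
    by apply/norm_cvg0P.
have tN' i j : tame (fun c => N' c i j) by case: (dN i j).
have cN' (c : config) (x : R) i j : N' (upd c t y) i j @[y --> x] --> N' (upd c t x) i j.
  by case: (dN i j) => _ _ _; exact.
move=> i j; split => //.
- under eq_fun do rewrite mxE.
  by apply: tameN; apply: tame_mxM => //; exact: tame_mxM.
- move=> c x.
  suff cv : h^-1 *: (K (upd c t (h *: 1 + x)) i j - K (upd c t x) i j) @[h --> 0^'] -->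
      (- (K (upd c t x) *m N' (upd c t x) *m K (upd c t x))) i j.
    apply: DeriveDef; first by apply/cvg_ex; eexists; exact: cv.
    exact: cvg_lim cv.
  have E (h : R) : h^-1 *: (K (upd c t (h *: 1 + x)) i j - K (upd c t x) i j) =
    - (K (upd c t (h *: 1 + x)) *m (h^-1 *:
        (N (upd c t (h *: 1 + x)) - N (upd c t x))) *m K (upd c t x)) i j.
    transitivity ((h^-1 *: (K (upd c t (h *: 1 + x)) - K (upd c t x))) i j).
      by rewrite !mxE.
    by rewrite resolvent scalerN mxE -scalemxAr -scalemxAl.
  rewrite (_ : (fun h => h^-1 *: _) = fun h =>
    - (K (upd c t (h *: 1 + x)) *m (h^-1 *:
        (N (upd c t (h *: 1 + x)) - N (upd c t x))) *m K (upd c t x)) i j);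
    last exact/funext/E.
  rewrite [X in _ --> X]mxE; apply: cvgN.
  apply: cvg_entry_mulmx => [a b|a b]; last exact: cvg_cst.
  apply: cvg_entry_mulmx => {a b} [a b|a b].
    have cx : h *: 1 + x @[h --> (0 : R)^'] --> x.
      rewrite -[X in _ --> X]add0r; apply: cvgD; last exact: cvg_cst.
      rewrite -[X in _ --> X](scale0r (1 : R)); apply: cvgZr_tmp.
      exact: cvg_within.
    exact: cvg_comp cx (cK c x a b).
  have [_ _ dNab _] := dN a b; have [ex <-] := dNab c x.
  apply: eq_fun_cvg ex => h; rewrite !mxE //.
- move=> c x; apply: (eq_fun_cvg (g := fun y =>
      - (K (upd c t y) *m N' (upd c t y) *m K (upd c t y)) i j)).
    by move=> y; rewrite mxE.
  rewrite [X in _ --> X]mxE; apply: cvgN.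
  apply: cvg_entry_mulmx => [a b|a b]; last exact: cK.
  by apply: cvg_entry_mulmx => {a b} [a b|a b]; [exact: cK|exact: cN'].
Qed.

End MatrixDerivative.

(** * Contraction by random row steps *)

Lemma msq_cols (R : realType) p q (X : 'M[R]_(p, q)) :
  \sum_j msq (col j X) = msq X.
Proof.
rewrite [RHS]msqE [RHS]exchange_big /=; apply: eq_bigr => j _; rewrite msqE.
by apply: eq_bigr => i _; rewrite big_ord1 mxE.
Qed.

Section GaussianMatrix.
Variables (R : realType) (m s : nat).
Local Notation I := ('I_m * 'I_s)%type.
Local Notation config := (config R I).

Definition mx_of (c : config) : 'M[R]_(m, s) := \matrix_(i, j) c (i, j).

Lemma pderiv_mx_of i j : pderiv_mx (i, j) mx_of (fun=> delta_mx i j).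
Proof.
move=> a b; under [X in pderiv _ X]eq_fun do rewrite mxE.
under [X in pderiv _ _ X]eq_fun do rewrite mxE -xpair_eqE.
exact: pderiv_coord.
Qed.

Lemma measurable_mx_of : measurable_mx mx_of.
Proof.
move=> i j; rewrite (_ : (fun c => _) = fun c : config => c (i, j)).
  exact: measurable_coord.
by apply/funext => c; rewrite mxE.
Qed.

Variable mu : probability config R.
Hypothesis mu_gauss : gaussian_law mu.
Local Notation E := (expect mu).

Section Moments.
Variable j : 'I_s.

Definition lin (w : 'cV[R]_m) (c : config) : R := mdot w (col j (mx_of c)).

Lemma linE w c : lin w c = \sum_i w i 0 * c (i, j).
Proof. by rewrite /lin mdotE; apply: eq_bigr => i _; rewrite big_ord1 !mxE. Qed.

Lemma pderiv_lin i w : pderiv (i, j) (lin w) (fun=> w i 0).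
Proof.
have h : pderiv (i, j) (fun c => \sum_k w k 0 * c (k, j))
    (fun c => \sum_k (0 * c (k, j) + w k 0 * ((k, j) == (i, j))%:R)).
  apply: pderiv_sum => k.
  exact: (pderivM (pderiv_cst (i, j) (w k 0)) (pderiv_coord R (i, j) (k, j))).
congr (pderiv _ _ _) : h; apply/funext => c; first by rewrite linE.
rewrite (bigD1 i)//= eqxx mul0r add0r mulr1 big1 ?addr0// => k ki.
by rewrite xpair_eqE (negbTE ki) mul0r mulr0 addr0.
Qed.

Lemma tame_lin w : tame (lin w).
Proof.
rewrite (_ : lin w = fun c => \sum_i w i 0 * c (i, j)); last exact/funext/linE.
by apply: tame_sum => i; apply: tameZ; exact: tame_coord.
Qed.

Lemma stein_lin w f (f' : 'I_m -> config -> R) :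
  (forall i, pderiv (i, j) f (f' i)) ->
  E (fun c => lin w c * f c) = E (fun c => \sum_i w i 0 * f' i c).
Proof.
move=> df.
have tf i : tame (fun c => c (i, j) * f c).
  by apply: tameM (tame_coord _ _) _; case: (df i).
have tf' i : tame (f' i) by case: (df i).
rewrite (_ : (fun c => _) = fun c => \sum_i w i 0 * (c (i, j) * f c)).
  2: by apply/funext => c; rewrite linE mulr_suml; apply: eq_bigr => i _; rewrite mulrA.
rewrite !expect_sum// => [|i|i]; [|exact: tameZ..].
by apply: eq_bigr => i _; rewrite !expectZ// (stein mu_gauss (df i)).
Qed.

Lemma sum_mul_col (v w : 'cV[R]_m) : \sum_i v i 0 * w i 0 = mdot v w.
Proof. by rewrite mdotE; apply: eq_bigr => i _; rewrite big_ord1. Qed.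

Lemma expect_lin2 v w : E (fun c => lin v c * lin w c) = mdot v w.
Proof.
rewrite (stein_lin _ (fun i => pderiv_lin i w)) -sum_mul_col.
exact: expect_cst.
Qed.

(** Isserlis' formula for two linear forms, by one integration by parts. *)
Lemma expect_lin4 w d : E (fun c => lin w c * (lin w c * (lin d c * lin d c))) =
  msq w * msq d + 2 * mdot w d ^+ 2.
Proof.
have dd i := pderivM (pderiv_lin i d) (pderiv_lin i d).
rewrite (stein_lin _ (fun i => pderivM (pderiv_lin i w) (dd i))).
rewrite (_ : (fun c => _) = fun c => msq w * (lin d c * lin d c) +
    (2 * mdot w d) * (lin w c * lin d c)); last first.
  apply/funext => c; move: (lin w c) (lin d c) => u v.
  rewrite /msq -!sum_mul_col mulr_sumr !mulr_suml -big_split /=.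
  by apply: eq_bigr => i _; ring.
have t2 v1 v2 : tame (fun c => lin v1 c * lin v2 c) by apply: tameM; exact: tame_lin.
rewrite expectD//; [|exact: tameZ..]; rewrite !expectZ// !expect_lin2 -/(msq d).
by ring.
Qed.

Lemma expect_lin4_le w d :
  E (fun c => lin w c * (lin w c * (lin d c * lin d c))) <= 3 * (msq w * msq d).
Proof. by rewrite expect_lin4; have := mdot_CS w d; lra. Qed.

Variables (n : nat) (A : 'M[R]_(m, n)) (t : R).

(** One step of size [t] along the gradient of [(a . z)^2 / 2], where [a] is the
    row of the sketched matrix given by the [j]-th column of the sketch. *)
Definition row_step (c : config) (z : 'cV[R]_n) : 'cV[R]_n :=
  z - (t * lin (A *m z) c) *: (A^T *m col j (mx_of c)).

Lemma msq_row_step c z : msq (row_step c z) = msq z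
  - 2 * t * (lin (A *m z) c * lin (A *m z) c)
  + t ^+ 2 * \sum_l (lin (A *m z) c * (lin (A *m z) c *
       (lin (col l A) c * lin (col l A) c))).
Proof.
rewrite /row_step msqD msqN msqZ mdotNr mdotZr -mdot_mull -/(lin _ _).
rewrite exprMn -!mulr_sumr; congr (_ + _); first by ring.
rewrite -mulrA; congr (_ * _); rewrite expr2 -mulrA; do 2![congr (_ * _)].
rewrite msqE; apply: eq_bigr => l _; rewrite big_ord1 -expr2; congr (_ ^+ 2).
rewrite linE mxE; apply: eq_bigr => i _; by rewrite !mxE.
Qed.

Lemma tame_msq_row_step z : tame (fun c => msq (row_step c z)).
Proof.
under eq_fun do rewrite msq_row_step.
have tl w := tame_lin w.
apply: tameD; [apply: tameB; first exact: tame_cst|]; apply: tameZ.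
  exact: tameM.
by apply: tame_sum => l; do 3![apply: tameM => //].
Qed.

Lemma expect_msq_row_step z : E (fun c => msq (row_step c z)) <=
  msq z - 2 * t * msq (A *m z) + t ^+ 2 * (3 * (msq (A *m z) * msq A)).
Proof.
have tl w := tame_lin w.
have t2 : tame (fun c => lin (A *m z) c * lin (A *m z) c) by exact: tameM.
have t4 l : tame (fun c => lin (A *m z) c * (lin (A *m z) c *
       (lin (col l A) c * lin (col l A) c))) by do 3![apply: tameM => //].
under [X in E X]eq_fun do rewrite msq_row_step.
rewrite expectD; last 2 first.
- by apply: tameB; [exact: tame_cst|exact: tameZ].
- by apply: tameZ; exact: tame_sum.
rewrite expectB//; [|exact: tame_cst|exact: tameZ].
rewrite !expectZ//; last exact: tame_sum.
rewrite expect_cst expect_lin2 expect_sum// lerD2l ler_wpM2l ?sqr_ge0//.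
apply: (@le_trans _ _ (\sum_l 3 * (msq (A *m z) * msq (col l A)))).
  by apply: ler_sum => l _; exact: expect_lin4_le.
  by rewrite -!mulr_sumr (msq_cols A).
exact: mu_gauss.
Qed.

End Moments.
End GaussianMatrix.

Section RowSteps.
Variables (R : realType) (m s n : nat).
Local Notation I := ('I_m * 'I_s)%type.
Local Notation config := (config R I).
Variables (A : 'M[R]_(m, n)) (t : R) (y : 'cV[R]_n).

Definition row_steps (r : seq 'I_s) (c : config) : 'cV[R]_n :=
  foldr (fun j z => row_step j A t c z) y r.

Lemma measurable_row_steps r : measurable_mx (row_steps r).
Proof.
elim: r => [|j r IH] /=; first exact: measurable_mx_cst.
have mc : measurable_mx (fun c : config => col j (mx_of c)).
  by apply: measurable_mx_col; exact: measurable_mx_of.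
apply: measurable_mxB => //; apply: measurable_mxZ; last first.
  by apply: measurable_mxM => //; exact: measurable_mx_cst.
apply: measurable_funM => //; apply: measurable_mdot => //.
by apply: measurable_mxM => //; exact: measurable_mx_cst.
Qed.

Lemma col_mix j (c c' : config) :
  col j (mx_of (mix (fun p => p.2 == j) c c')) = col j (mx_of c').
Proof. by apply/colP => i; rewrite !mxE /mix /= eqxx. Qed.

Lemma row_steps_mix r j (c c' : config) : j \notin r ->
  row_steps r (mix (fun p => p.2 == j) c c') = row_steps r c.
Proof.
elim: r => //= k r IH; rewrite inE negb_or => /andP[jk /IH ->].
rewrite /row_step /lin; suff -> : col k (mx_of (mix (fun p => p.2 == j) c c')) =
  col k (mx_of c) by [].
by apply/colP => i; rewrite !mxE /mix /= eq_sym (negbTE jk).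
Qed.

(** All the steps stay in the row space of the sketched matrix, hence the
    comparison with the projection. *)
Lemma row_stepsE r c : exists w, row_steps r c = y - ((mx_of c)^T *m A)^T *m w.
Proof.
elim: r => [|j r [w IH]] /=; first by exists 0; rewrite mulmx0 subr0.
rewrite /row_step {1}IH; set a := t * _.
exists (w + a *: delta_mx j 0).
rewrite mulmxDr opprD addrA; congr (_ - _).
by rewrite -scalemxAr trmx_mul trmxK -mulmxA -colE.
Qed.

Variable mu : probability config R.
Hypothesis mu_gauss : gaussian_law mu.

(** A column outside [r] is independent of [row_steps r]: redraw it alone. *)
Lemma integral_row_steps_le (q : R) r : 0 <= q -> uniq r ->
  (forall j z, expect mu (fun c => msq (row_step j A t c z)) <= q * msq z) ->
  (\int[mu]_c (msq (row_steps r c))%:E <= (q ^+ size r * msq y)%:E)%E.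
Proof.
move=> q0 + hq; elim: r => [_|j r IH /andP[jr ur]] /=.
  by rewrite (expectE mu_gauss (tame_cst _ _)) expect_cst expr0 mul1r.
have mrs r' : measurable_fun setT (fun c => (msq (row_steps r' c))%:E).
  by apply/measurable_EFinP; apply: measurable_msq; exact: measurable_row_steps.
apply: (@le_trans _ _ (\int[mu]_c (q%:E * (msq (row_steps r c))%:E))%E).
  apply: (le_integral_mix mu_gauss (U := fun p => p.2 == j)) => //.
  - exact: (mrs (j :: r)).
  - by move=> c; rewrite lee_fin msq_ge0.
  - by apply: emeasurable_funM.
  - move=> c; rewrite -EFinM.
    rewrite (eq_integral (fun c' => (msq (row_step j A t c' (row_steps r c)))%:E)).
      rewrite (expectE mu_gauss); last exact: tame_msq_row_step.
      by rewrite lee_fin hq.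
    by move=> c' _; rewrite row_steps_mix// /row_step /lin col_mix.
rewrite ge0_integralZl// => [|c _]; last by rewrite lee_fin msq_ge0.
rewrite exprS -mulrA EFinM lee_wpmul2l ?lee_fin//.
exact: IH.
Qed.

End RowSteps.

Section Contraction.
Variables (R : realType) (m s n : nat) (A : 'M[R]_(m, n)).
Local Notation config := (config R ('I_m * 'I_s)%type).
Variable mu : probability config R.
Hypothesis mu_gauss : gaussian_law mu.

(** Projecting out the row space of the sketched matrix does at least as well
    as one gradient step per row. *)
Lemma integral_compl_row_proj_le (sg : R) (y : 'cV[R]_n) :
  0 < msq A -> 0 <= sg -> sg <= msq A ->
  (forall z : 'cV[R]_n, sg * msq z <= msq (A *m z)) ->
  (\int[mu]_c (msq ((1%:M - moore_penrose ((mx_of c)^T *m A) *m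
                       ((mx_of c)^T *m A)) *m y))%:E <=
   ((1 - sg / (3 * msq A)) ^+ s * msq y)%:E)%E.
Proof.
move=> A0 sg0 sgA sgP.
(* This step minimizes [- 2 t + 3 t ^+ 2 * msq A], the factor of
   [msq (A *m z)] in [expect_msq_row_step]. *)
pose t := (3 * msq A)^-1.
have t0 : 0 < t by rewrite invr_gt0 mulr_gt0.
have q0 : 0 <= 1 - sg / (3 * msq A).
  by rewrite subr_ge0 ler_pdivrMr ?mulr_gt0// mul1r; lra.
apply: (@le_trans _ _ (\int[mu]_c (msq (row_steps A t y (enum 'I_s) c))%:E)%E).
  apply: ge0_le_integral => //.
  - by move=> c _; rewrite lee_fin msq_ge0.
  - apply/measurable_EFinP; apply: measurable_msq.
    have mM : measurable_mx (fun c : config => (mx_of c)^T *m A).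
      apply: measurable_mxM; last exact: measurable_mx_cst.
      by apply: measurable_mxT; exact: measurable_mx_of.
    apply: measurable_mxM; last exact: measurable_mx_cst.
    apply: measurable_mxB; first exact: measurable_mx_cst.
    by apply: measurable_mxM => //; exact: measurable_moore_penrose.
  - by apply/measurable_EFinP; apply: measurable_msq; exact: measurable_row_steps.
  - move=> c cT; have [w ->] := row_stepsE A t y (enum 'I_s) c.
    by rewrite lee_fin msq_compl_row_proj.
have hq j z : expect mu (fun c => msq (row_step j A t c z)) <=
    (1 - sg / (3 * msq A)) * msq z.
  apply: (le_trans (expect_msq_row_step mu_gauss j A t z)).
  have := sgP z; set a := msq (A *m z); set b := msq z => h.
  have -> : b - 2 * t * a + t ^+ 2 * (3 * (a * msq A)) = b - t * a.
    by rewrite /t; field; rewrite gt_eqF.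
  by rewrite mulrBl mul1r lerD2l lerN2 -/t mulrAC mulrC ler_pM2l.
have := integral_row_steps_le y mu_gauss q0 (enum_uniq 'I_s) hq.
by rewrite size_enum_ord.
Qed.

End Contraction.

(** * Divergence of the fields [Q S K] *)

Lemma mul_delta_entry (R : realType) p q r u (X : 'M[R]_(p, q)) (Y : 'M[R]_(r, u))
    i j a b : (X *m delta_mx i j *m Y) a b = X a i * Y j b.
Proof.
have -> : X *m delta_mx i j = \matrix_(a', k) (X a' i * (k == j)%:R).
  apply/matrixP => a' k; rewrite !mxE (bigD1 i)//= mxE eqxx /= big1 ?addr0// => k' k'i.
  by rewrite mxE (negbTE k'i) mulr0.
rewrite mxE (bigD1 j)//= mxE eqxx mulr1 big1 ?addr0// => k kj.
by rewrite mxE (negbTE kj) mulr0 mul0r.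
Qed.

Section Divergence.
Variables (R : realType) (m s n : nat) (A : 'M[R]_(m, n)) (l : R).
Local Notation config := (config R ('I_m * 'I_s)%type).
Hypothesis l0 : 0 < l.

Definition sketched (c : config) : 'M[R]_(s, n) := (mx_of c)^T *m A.
Definition sketchK (c : config) : 'M[R]_s := regK (sketched c) l.
Local Notation S := (@mx_of R m s).
Local Notation M := sketched.
Local Notation K := sketchK.

Lemma eq_pderiv_mx p q t (F F' G' : config -> 'M[R]_(p, q)) :
  F' =1 G' -> pderiv_mx t F F' -> pderiv_mx t F G'.
Proof. by move=> /funext ->. Qed.

Lemma pderiv_sketched i j :
  pderiv_mx (i, j) M (fun=> delta_mx j i *m A).
Proof.
apply: eq_pderiv_mx (pderiv_mxM (pderiv_mxT (@pderiv_mx_of R m s i j))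
  (pderiv_mx_cst _ A)) => c.
by rewrite mulmx0 addr0 trmx_delta.
Qed.

Let dW i j c := delta_mx j i *m A *m (M c)^T + M c *m (delta_mx j i *m A)^T.

Lemma pderiv_sketchK i j :
  pderiv_mx (i, j) K (fun c => - (K c *m dW i j c *m K c)).
Proof.
have dM := pderiv_sketched i j.
apply: (@pderiv_inv _ _ _ _ (fun c => regN (M c) l) (dW i j) K l^-1).
- apply: eq_pderiv_mx (pderiv_mxD (pderiv_mxM dM (pderiv_mxT dM))
    (pderiv_mx_cst _ l%:M)) => c.
  by rewrite addr0.
- by move=> c; exact: mul_regNK.
- by move=> c; exact: mul_regKN.
- apply: measurable_regK => //; apply: measurable_mxM; last exact: measurable_mx_cst.
  by apply: measurable_mxT; exact: measurable_mx_of.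
- by move=> c a b; exact: regK_entry.
Qed.

Lemma pderiv_field (Q : 'M[R]_m) i j :
  pderiv_mx (i, j) (fun c => Q *m S c *m K c)
    (fun c => Q *m delta_mx i j *m K c - Q *m S c *m (K c *m dW i j c *m K c)).
Proof.
apply: eq_pderiv_mx (pderiv_mxM (pderiv_mxM (pderiv_mx_cst (i, j) Q)
  (@pderiv_mx_of R m s i j)) (pderiv_sketchK i j)) => c.
by rewrite mul0mx add0r mulmxN.
Qed.

Lemma field_entry (Q : 'M[R]_m) i j c :
  (Q *m delta_mx i j *m K c - Q *m S c *m (K c *m dW i j c *m K c)) i j =
  Q i i * K c j j
  - (Q *m S c *m K c) i j * (A *m (M c)^T *m K c) i j
  - (Q *m S c *m K c *m M c *m A^T) i i * K c j j.
Proof.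
rewrite /dW (trmx_mul (delta_mx j i)) trmx_delta mulmxDr mulmxDl mulmxDr.
rewrite [LHS]mxE [X in _ + X]mxE.
rewrite [X in - X]mxE opprD addrA.
rewrite (_ : Q *m S c *m (K c *m (delta_mx j i *m A *m (M c)^T) *m K c) =
  Q *m S c *m K c *m delta_mx j i *m (A *m (M c)^T *m K c)); last by rewrite !mulmxA.
rewrite (_ : Q *m S c *m (K c *m (M c *m (A^T *m delta_mx i j)) *m K c) =
  Q *m S c *m K c *m M c *m A^T *m delta_mx i j *m K c); last by rewrite !mulmxA.
by rewrite !mul_delta_entry.
Qed.

Lemma sum_pair_diag (X : 'M[R]_m) (Y : 'M[R]_s) :
  \sum_(p : 'I_m * 'I_s) X p.1 p.1 * Y p.2 p.2 = \tr X * \tr Y.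
Proof.
rewrite -(pair_bigA _ (fun i j => X i i * Y j j)) /= /mxtrace mulr_suml.
by apply: eq_bigr => i _; rewrite mulr_sumr.
Qed.

Variable mu : probability config R.
Hypothesis mu_gauss : gaussian_law mu.
Local Notation E := (expect mu).

Lemma tame_mx_of i j : tame (fun c => S c i j).
Proof. by case: (@pderiv_mx_of R m s i j i j). Qed.

Lemma tame_sketched i j : tame (fun c => M c i j).
Proof.
apply: tame_mxM => a b; last exact: tame_cst.
by under eq_fun do rewrite mxE; exact: tame_mx_of.
Qed.

Lemma tame_sketchedT i j : tame (fun c => (M c)^T i j).
Proof. by under eq_fun do rewrite mxE; exact: tame_sketched. Qed.

Lemma tame_sketchK i j : tame (fun c => K c i j).
Proof.
apply: (tame_bounded (C := l^-1)) => [|c]; last exact: regK_entry.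
apply: measurable_regK => //; apply: measurable_mxM; last exact: measurable_mx_cst.
by apply: measurable_mxT; exact: measurable_mx_of.
Qed.

(** Gaussian integration by parts for the field [S |-> Q S K(S)]: the three
    terms are the divergence, [S] occurring linearly in front of [K] and twice
    inside [K]. *)
Lemma expect_field (Q : 'M[R]_m) :
  E (fun c => mdot (S c) (Q *m S c *m K c)) =
  E (fun c => \tr Q * \tr (K c)
     - mdot (Q *m S c *m K c) (A *m (M c)^T *m K c)
     - \tr (Q *m S c *m K c *m M c *m A^T) * \tr (K c)).
Proof.
rewrite (_ : (fun c => mdot (S c) _) = fun c =>
    \sum_(p : 'I_m * 'I_s) c p * (Q *m S c *m K c) p.1 p.2); last first.
  apply/funext => c; rewrite mdotE pair_bigA; apply: eq_bigr => -[i j] _ /=.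
  by rewrite mxE.
rewrite (_ : (fun c => _ - _) = fun c => \sum_(p : 'I_m * 'I_s)
    (Q *m delta_mx p.1 p.2 *m K c - Q *m S c *m (K c *m dW p.1 p.2 c *m K c)) p.1 p.2).
  2: apply/funext => c; under eq_bigr do rewrite field_entry;
     rewrite !sumrB !sum_pair_diag mdotE pair_bigA; by [].
have df (p : 'I_m * 'I_s) := pderiv_field Q p.1 p.2 p.1 p.2.
rewrite !expect_sum//.
- apply: eq_bigr => -[i j] _ /=; exact: (stein mu_gauss (df (i, j))).
- by move=> [i j]; case: (df (i, j)).
- by move=> p; apply: tameM (tame_coord _ _) _; case: (df p).
Qed.

End Divergence.

(** * Expected trace of the regularized inverse *)

Section TraceInequalities.
Variables (R : realType) (m n s : nat).

(** Substitutes for the last [K] its decomposition [regK_sum]; with [Q = 1] the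
    left side is [tr (M M^T K) <= s], which allows comparing [Q] with [1]. *)
Lemma tr_sandwich_regK (M : 'M[R]_(s, n)) (Q : 'M[R]_n) (l : R) : 0 < l ->
  let K := regK M l in
  \tr (M *m Q *m M^T *m K) =
  mdot (M^T *m K *m M) (Q *m (M^T *m K *m M)) +
  l * mdot (M^T *m K) (Q *m (M^T *m K)).
Proof.
move=> l0 K; have KT : K^T = K by exact: regK_tr.
rewrite {1}/K regK_sum// -/K mulmxDr mxtraceD -scalemxAr mxtraceZ.
rewrite /mdot !trmx_mul !trmxK KT !mulmxA; congr (_ + _ * _).
  by rewrite -[X in \tr X = _]mulmxA mxtrace_mulC !mulmxA.
by rewrite mxtrace_mulC !mulmxA.
Qed.

Variables (A : 'M[R]_(m, n)) (sg : R).
Hypothesis rA : \rank A = n.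
Hypothesis sg0 : 0 < sg.
Hypothesis sgP : forall z : 'cV[R]_n, sg * msq z <= msq (A *m z).
Let Gi := invmx (A^T *m A).

Lemma gram_unit : A^T *m A \in unitmx.
Proof.
rewrite -{2}(trmxK A); apply: row_free_gram.
by rewrite /row_free mxrank_tr rA.
Qed.

(** With [U = (A^T A)^-1 V] the left side is [msq (A *m U)] and also [mdot V U],
    so Cauchy-Schwarz and the coercivity of [A] close the loop. *)
Lemma mdot_invgram_le p (V : 'M[R]_(n, p)) : mdot V (Gi *m V) <= sg^-1 * msq V.
Proof.
set U := Gi *m V.
have VE : V = A^T *m A *m U by rewrite /U mulmxA mulmxV ?gram_unit// mul1mx.
have VU : mdot V U = msq (A *m U).
  by rewrite {1}VE -mulmxA mdotC -mdot_mull.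
have sgU : sg * msq U <= msq (A *m U).
  rewrite -(msq_cols U) -(msq_cols (A *m U)) mulr_sumr; apply: ler_sum => j _.
  by rewrite (le_trans (sgP _))// colE mulmxA -colE.
have := mdot_CS V U; rewrite VU.
have := msq_ge0 U; have := msq_ge0 (A *m U); have := msq_ge0 V.
move: sgU; set a := msq (A *m U); set u := msq U; set v := msq V => sgU v0 a0 u0 h.
rewrite mulrC ler_pdivlMr//.
have [->|an0] := eqVneq a 0; first by rewrite mul0r.
have agt0 : 0 < a by rewrite lt_neqAle eq_sym an0.
rewrite -(ler_pM2r agt0) mulrAC -expr2 (le_trans (ler_wpM2r (ltW sg0) h))//.
by rewrite -mulrA ler_wpM2l// mulrC.
Qed.

Lemma tr_sandwich_invgram_le (M : 'M[R]_(s, n)) (l : R) : 0 < l ->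
  \tr (M *m Gi *m M^T *m regK M l) <= s%:R / sg.
Proof.
move=> l0; rewrite tr_sandwich_regK//=.
set V := M^T *m _ *m _; set V2 := M^T *m _.
apply: (@le_trans _ _ (sg^-1 * (msq V + l * msq V2))).
  rewrite mulrDr lerD ?mdot_invgram_le// mulrCA ler_wpM2l ?(ltW l0)//.
  exact: mdot_invgram_le.
rewrite mulrC ler_wpM2r ?invr_ge0 ?(ltW sg0)//.
have := tr_sandwich_regK M 1%:M l0; rewrite /= mulmx1 !mul1mx => <-.
exact: tr_gramK_le.
Qed.

Local Notation config := (config R ('I_m * 'I_s)%type).
Variable mu : probability config R.
Hypothesis mu_gauss : gaussian_law mu.
Local Notation E := (expect mu).
Local Notation S := (@mx_of R m s).
Local Notation M := (@sketched R m s n A).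
Variable l : R.
Hypothesis l0 : 0 < l.
Local Notation K := (@sketchK R m s n A l).

Lemma tame_tr_sketchK : tame (fun c => \tr (K c)).
Proof. by apply: tame_mxtrace => i j; exact: tame_sketchK. Qed.

(** The trace of an inverse Wishart matrix, as an inequality: integration by
    parts for the field [Q S K], where [Q = A (A^T A)^-1 A^T] projects onto the
    range of [A]. Its divergence is at least [(n - 1 - s) tr K], and its inner
    product with [S] is at most [s / sg]. *)
Lemma expect_tr_sketchK_le : (n%:R - s%:R - 1) * E (fun c => \tr (K c)) <= s%:R / sg.
Proof.
have tK := tame_sketchK (s := s) A l0; have tM := @tame_sketched R m s n A.
have tMT := @tame_sketchedT R m s n A.
have tS := @tame_mx_of R m s.
pose Q := A *m Gi *m A^T.
have QT : Q^T = Q.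
  by rewrite /Q !trmx_mul trmxK trmx_inv trmx_mul trmxK mulmxA.
have QA : Q *m A = A by rewrite /Q -!mulmxA mulVmx ?gram_unit// mulmx1.
have ATQ : A^T *m Q = A^T by rewrite -QT -trmx_mul QA.
have trQ : \tr Q = n%:R.
  by rewrite /Q -mulmxA mxtrace_mulC -mulmxA mulVmx ?gram_unit// mxtrace1.
have QE : Q = A *m Gi *m A^T by [].
clearbody Q.
have tcM p q r (F : config -> 'M[R]_(p, q)) (X : 'M[R]_(r, p)) :
    (forall i j, tame (fun c => F c i j)) -> forall i j, tame (fun c => (X *m F c) i j).
  by move=> tF; apply: tame_mxM => // i j; exact: tame_cst.
have tF : forall i j, tame (fun c => (Q *m S c *m K c) i j).
  by apply: tame_mxM => //; exact: tcM.
have tl : tame (fun c => mdot (S c) (Q *m S c *m K c)).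
  under eq_fun do rewrite mdotE.
  by apply: tame_sum => i; apply: tame_sum => j; apply: tameM.
apply: (@le_trans _ _ (E (fun c => mdot (S c) (Q *m S c *m K c)))); last first.
  rewrite -[leRHS](expect_cst mu); apply: le_expect => //; first exact: tame_cst.
  move=> c; rewrite /mdot QE.
  have -> : (S c)^T *m (A *m Gi *m A^T *m S c *m K c) =
    M c *m Gi *m (M c)^T *m K c.
    by rewrite /sketched trmx_mul trmxK !mulmxA.
  exact: tr_sandwich_invgram_le.
rewrite (expect_field A l0 mu_gauss) -expectZ//; last exact: tame_tr_sketchK.
have tt := tame_tr_sketchK.
apply: le_expect => //; first exact: tameZ.
  apply: tameB; [apply: tameB; first exact: tameZ|apply: tameM => //].
    under eq_fun do rewrite mdotE.
    apply: tame_sum => i; apply: tame_sum => j; apply: tameM => //.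
    by apply: tame_mxM => //; exact: tcM.
  apply: tame_mxtrace; apply: tame_mxM => [i j|i j]; last exact: tame_cst.
  exact: tame_mxM.
move=> c; rewrite trQ.
have -> : mdot (Q *m S c *m K c) (A *m (M c)^T *m K c) =
    \tr (K c *m (M c *m (M c)^T) *m K c).
  rewrite /mdot (trmx_mul (Q *m S c)) (trmx_mul Q) QT /sketchK regK_tr.
  rewrite -!mulmxA (mulmxA Q) QA.
  by rewrite (mulmxA (S c)^T).
have -> : \tr (Q *m S c *m K c *m M c *m A^T) = \tr (M c *m (M c)^T *m K c).
  rewrite mxtrace_mulC !mulmxA ATQ mxtrace_mulC !mulmxA.
  by rewrite /sketched trmx_mul trmxK !mulmxA mxtrace_mulC !mulmxA.
have h1 := tr_regK_gramK_le (M c) l0; have h2 := tr_gramK_le (M c) l0.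
have h3 := tr_regK_ge0 (M c) l0.
rewrite -/(K c) in h1 h2 h3 *.
move: h1 h2 h3; set k := \tr (K c); set a := \tr (K c *m _ *m _).
set b := \tr (M c *m _ *m _).
by move=> h1 h2 h3; have := ler_wpM2r h3 h2; lra.
Qed.

Variable e : 'cV[R]_m.
Hypothesis e_orth : A^T *m e = 0.

Lemma tame_residual : tame (fun c => mdot ((S c)^T *m e) (K c *m ((S c)^T *m e))).
Proof.
have tS i j : tame (fun c => ((S c)^T *m e) i j).
  apply: tame_mxM => a b; last exact: tame_cst.
  by under eq_fun do rewrite mxE; exact: tame_mx_of.
under eq_fun do rewrite mdotE.
apply: tame_sum => i; apply: tame_sum => j; apply: tameM => //.
by apply: tame_mxM => // a b; exact: tame_sketchK.
Qed.

(** Moving [S] along [e] does not move [S^T A], so only the divergence of the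
    linear factor survives. This is the infinitesimal form of the independence
    of [S^T e] and [S^T A]. *)
Lemma expect_residual :
  E (fun c => mdot ((S c)^T *m e) (K c *m ((S c)^T *m e))) =
  msq e * E (fun c => \tr (K c)).
Proof.
have eA : e^T *m A = 0 by rewrite -[A]trmxK -trmx_mul e_orth trmx0.
rewrite -expectZ//; last exact: tame_tr_sketchK.
transitivity (E (fun c => mdot (S c) ((e *m e^T) *m S c *m K c))).
  congr expect; apply/funext => c.
  by rewrite /mdot trmx_mul trmxK [X in \tr X = _]mulmxA mxtrace_mulC !mulmxA.
rewrite (expect_field A l0 mu_gauss); congr expect; apply/funext => c.
rewrite [\tr (e *m e^T)]mxtrace_mulC -/(mdot e e) -/(msq e).
rewrite [X in _ - X * _]mxtrace_mulC !mulmxA e_orth !mul0mx mxtrace0 mul0r subr0.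
rewrite /mdot !trmx_mul trmxK -!mulmxA (mulmxA e^T) eA mul0mx !mulmx0 mxtrace0.
by rewrite subr0.
Qed.

Lemma expect_msq_reg_pinv_le : (s.+1 < n)%N ->
  (\int[mu]_c (msq ((M c)^T *m K c *m ((S c)^T *m e)))%:E <=
   (msq e * (s%:R / sg / (n%:R - s%:R - 1)))%:E)%E.
Proof.
move=> sn; have d0 : 0 < n%:R - s%:R - 1 :> R.
  by rewrite -addrA -opprD natr1 subr_gt0 ltr_nat.
apply: (@le_trans _ _ (E (fun c => mdot ((S c)^T *m e) (K c *m ((S c)^T *m e))))%:E).
  rewrite -(expectE mu_gauss); last exact: tame_residual.
  apply: ge0_le_integral => //.
  - by move=> c _; rewrite lee_fin msq_ge0.
  - have mS : measurable_mx S by exact: measurable_mx_of.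
    have mM : measurable_mx M.
      by apply: measurable_mxM; [exact: measurable_mxT|exact: measurable_mx_cst].
    apply/measurable_EFinP; apply: measurable_msq; apply: measurable_mxM.
      by apply: measurable_mxM; [exact: measurable_mxT|exact: measurable_regK].
    by apply: measurable_mxM; [exact: measurable_mxT|exact: measurable_mx_cst].
  - by apply/measurable_EFinP; case: tame_residual.
  - by move=> c cT; rewrite lee_fin; exact: msq_trM_regK_le.
rewrite lee_fin expect_residual ler_wpM2l ?msq_ge0//.
by rewrite ler_pdivlMr// mulrC expect_tr_sketchK_le.
Qed.

End TraceInequalities.

(** * One step of the method *)

Section ResidualStep.
Variables (R : realType) (m n s : nat) (A : 'M[R]_(m, n)) (sg : R).
Hypothesis rA : \rank A = n.
Hypothesis sg0 : 0 < sg.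
Hypothesis sgP : forall z : 'cV[R]_n, sg * msq z <= msq (A *m z).
Local Notation config := (config R ('I_m * 'I_s)%type).
Variable mu : probability config R.
Hypothesis mu_gauss : gaussian_law mu.
Local Notation S := (@mx_of R m s).
Local Notation M := (@sketched R m s n A).

Lemma measurable_sketched : measurable_mx M.
Proof.
apply: measurable_mxM; last exact: measurable_mx_cst.
by apply: measurable_mxT; exact: measurable_mx_of.
Qed.

(** Fatou along [l = 1 / (k + 1)]. *)
Lemma integral_pinv_residual_le (e : 'cV[R]_m) : A^T *m e = 0 -> (s.+1 < n)%N ->
  (\int[mu]_c (msq (moore_penrose (M c) *m ((S c)^T *m e)))%:E <=
   (msq e * (s%:R / sg / (n%:R - s%:R - 1)))%:E)%E.
Proof.
move=> Ae sn.
pose f (k : nat) (c : config) : \bar R :=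
  (msq ((M c)^T *m regK (M c) k.+1%:R^-1 *m ((S c)^T *m e)))%:E.
have mf k : measurable_fun setT (f k).
  apply/measurable_EFinP; apply: measurable_msq; apply: measurable_mxM.
    apply: measurable_mxM; first by apply: measurable_mxT; exact: measurable_sketched.
    by apply: measurable_regK => //; exact: measurable_sketched.
  apply: measurable_mxM; last exact: measurable_mx_cst.
  by apply: measurable_mxT; exact: measurable_mx_of.
have f0 k c : setT c -> (0 <= f k c)%E by move=> _; rewrite lee_fin msq_ge0.
have cf c : f k c @[k --> \oo] -->
    (msq (moore_penrose (M c) *m ((S c)^T *m e)))%:E.
  apply: cvg_EFin; first exact: nearW.
  have cv i j : ((M c)^T *m regK (M c) k.+1%:R^-1 *m ((S c)^T *m e)) i j
      @[k --> \oo] --> (moore_penrose (M c) *m ((S c)^T *m e)) i j.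
    by apply: cvg_entry_mulmx => [a b|a b]; [exact: cvg_regK_pinv|exact: cvg_cst].
  rewrite msqE; apply: (eq_fun_cvg (g := fun k : nat => \sum_i \sum_j
    ((M c)^T *m regK (M c) k.+1%:R^-1 *m ((S c)^T *m e)) i j ^+ 2)).
    by move=> k; rewrite /= msqE.
  apply: cvg_big => [|i _]; first exact: add_continuous.
  apply: cvg_big => [|j _]; first exact: add_continuous.
  rewrite expr2; apply: (eq_fun_cvg (g := fun k : nat =>
    ((M c)^T *m regK (M c) k.+1%:R^-1 *m ((S c)^T *m e)) i j *
    ((M c)^T *m regK (M c) k.+1%:R^-1 *m ((S c)^T *m e)) i j)).
    by move=> k; rewrite expr2.
  by apply: cvgM; exact: cv.
have -> : (fun c => (msq (moore_penrose (M c) *m ((S c)^T *m e)))%:E) =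
    (fun c => limn_einf (f^~ c)).
  apply/funext => c; rewrite is_cvg_limn_einfE; last by apply/cvg_ex; eexists; exact: cf.
  exact/esym/cvg_lim/cf.
apply: (le_trans (fatou mu measurableT mf f0)).
rewrite limn_einf_lim; apply: lime_le; first exact: is_cvg_einfs.
apply: nearW => k; apply: (@le_trans _ _ (\int[mu]_c f k c)%E).
  by apply: ereal_inf_lbound; exists k => /=.
exact: expect_msq_reg_pinv_le.
Qed.

End ResidualStep.

Lemma bgk_stepE (R : realType) (m n s : nat) (A : 'M[R]_(m, n)) (b : 'cV[R]_m)
    (S : 'M[R]_(m, s)) (x xs : 'cV[R]_n) :
  bgk_step A b S x - xs =
  (1%:M - moore_penrose (S^T *m A) *m (S^T *m A)) *m (x - xs)
  - moore_penrose (S^T *m A) *m (S^T *m (A *m xs - b)).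
Proof.
rewrite /bgk_step; set X := moore_penrose _; set P := X *m _.
rewrite [in RHS]mulmxBr (mulmxBr S^T) (mulmxBr X) [S^T *m (A *m xs)]mulmxA.
rewrite [X *m (_ *m xs)]mulmxA -/P [(1%:M - P) *m xs]mulmxBl mul1mx.
move: (_ *m x) (P *m xs) (X *m (S^T *m b)) => u v w.
by apply/matrixP => i j; rewrite !mxE; ring.
Qed.

(** The two parts of the new error lie in complementary orthogonal subspaces. *)
Lemma msq_bgk_step (R : realType) (m n s : nat) (A : 'M[R]_(m, n)) (b : 'cV[R]_m)
    (S : 'M[R]_(m, s)) (x xs : 'cV[R]_n) :
  msq (bgk_step A b S x - xs) =
  msq ((1%:M - moore_penrose (S^T *m A) *m (S^T *m A)) *m (x - xs))
  + msq (moore_penrose (S^T *m A) *m (S^T *m (A *m xs - b))).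
Proof.
have QT : (1%:M - moore_penrose (S^T *m A) *m (S^T *m A))^T =
    1%:M - moore_penrose (S^T *m A) *m (S^T *m A).
  by rewrite linearB /= trmx1 row_proj_tr.
rewrite bgk_stepE msqD msqN mdotNr mdot_mull QT (mulmxA (1%:M - _)).
rewrite compl_row_proj_pinv mul0mx.
by rewrite /mdot mulmx0 mxtrace0 oppr0 mulr0 addr0.
Qed.

(** * Iterating *)

Definition mfun_of d d' (T : measurableType d) (T' : measurableType d')
    (f : T -> T') (mf : measurable_fun setT f) : {mfun T >-> T'} :=
  MeasurableFun.Pack (MeasurableFun.Class (isMeasurableFun.Build _ _ _ _ f mf)).

Section Marginal.
Variables (R : realType) (I J : choiceType) (h : J -> I).
Hypothesis h_inj : injective h.
Variable mu : probability (config R I) R.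
Hypothesis mu_gauss : gaussian_law mu.

Definition reindex (c : config R I) : config R J := fun j => c (h j).

Lemma measurable_reindex : measurable_fun setT reindex.
Proof. by apply: measurable_to_config => j; exact: measurable_coord. Qed.

Definition marginal : probability (config R J) R :=
  distribution mu (mfun_of measurable_reindex).

Lemma marginal_gauss : gaussian_law marginal.
Proof.
move=> r B ur mB.
pose B' i := \big[setI/setT]_(j <- r) (if h j == i then B j else setT).
have B'E j : j \in r -> B' (h j) = B j.
  move=> jr; rewrite /B' (bigD1_seq j)//= eqxx big1 ?setIT// => k kj.
  by rewrite (inj_eq h_inj) (negbTE kj).
transitivity (mu (cylinder (map h r) B')).
  congr (mu _); apply/seteqP; split => c /=.
    by move=> hc _ /mapP[j jr ->]; rewrite B'E//; exact: hc.
  by move=> hc j jr; have := hc (h j) (map_f h jr); rewrite B'E.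
rewrite mu_gauss ?map_inj_uniq// => [|i].
  by rewrite big_map big_seq [RHS]big_seq; apply: eq_bigr => j jr; rewrite B'E.
by apply: bigsetI_measurable => j _; case: ifP.
Qed.

Lemma ge0_integral_marginal (f : config R J -> \bar R) :
  measurable_fun setT f -> (forall c, (0 <= f c)%E) ->
  (\int[mu]_c f (reindex c) = \int[marginal]_c f c)%E.
Proof.
by move=> mf f0; rewrite (ge0_integral_distribution (mfun_of measurable_reindex)).
Qed.

End Marginal.

Section Iterates.
Variables (R : realType) (m n s : nat) (A : 'M[R]_(m, n)) (b : 'cV[R]_m).
Variables (xs x0 : 'cV[R]_n).
Local Notation I := (nat * 'I_m * 'I_s)%type.
Local Notation draws := (config R I).

Definition sketch_of (c : draws) (k : nat) : 'M[R]_(m, s) :=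
  \matrix_(i, j) c (k, i, j).

Definition block (k : nat) (p : 'I_m * 'I_s) : I := (k, p.1, p.2).

Lemma block_inj k : injective (block k).
Proof. by move=> [i j] [i' j'] [-> ->]. Qed.

Lemma sketch_ofE c k : sketch_of c k = mx_of (reindex (block k) c).
Proof. by apply/matrixP => i j; rewrite !mxE. Qed.

Definition iterate (c : draws) (k : nat) : 'cV[R]_n := bgk A b x0 (sketch_of c) k.

Lemma measurable_bgk_step d (T : measurableType d) (F : T -> 'M[R]_(m, s))
    (X : T -> 'cV[R]_n) : measurable_mx F -> measurable_mx X ->
  measurable_mx (fun w => bgk_step A b (F w) (X w)).
Proof.
move=> mF mX.
have mFT : measurable_mx (fun w => (F w)^T) by exact: measurable_mxT.
have mM : measurable_mx (fun w => (F w)^T *m A).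
  by apply: measurable_mxM => //; exact: measurable_mx_cst.
have mP : measurable_mx (fun w => moore_penrose ((F w)^T *m A)).
  exact: measurable_moore_penrose.
apply: measurable_mxD; apply: measurable_mxM => //.
- by apply: measurable_mxB; [exact: measurable_mx_cst|exact: measurable_mxM].
- by apply: measurable_mxM => //; exact: measurable_mx_cst.
Qed.

Lemma measurable_sketch_of k : measurable_mx (fun c => sketch_of c k).
Proof.
move=> i j; rewrite (_ : (fun c => _) = fun c : draws => c (k, i, j)).
  exact: measurable_coord.
by apply/funext => c; rewrite mxE.
Qed.

Lemma measurable_iterate k : measurable_mx (fun c => iterate c k).
Proof.
elim: k => [|k IH]; first exact: measurable_mx_cst.
by apply: measurable_bgk_step => //; exact: measurable_sketch_of.
Qed.

Lemma sketch_of_mix k (c c' : draws) :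
  sketch_of (mix (fun p => p.1.1 == k) c c') k = sketch_of c' k.
Proof. by apply/matrixP => i j; rewrite !mxE /mix /= eqxx. Qed.

Lemma iterate_mix k k' (c c' : draws) : (k <= k')%N ->
  iterate (mix (fun p => p.1.1 == k') c c') k = iterate c k.
Proof.
elim: k => // k IH kk'; rewrite /iterate /= -!/(iterate _ _) IH ?(ltnW kk')//.
congr bgk_step; apply/matrixP => i j.
by rewrite !mxE /mix /= (ltn_eqF kk').
Qed.

Variable mu : probability draws R.
Hypothesis mu_gauss : gaussian_law mu.

(** The block of draws number [k] is redrawn while the current iterate, which
    depends on the previous blocks only, is kept; [T0] is a bound that one step
    reproduces. *)
Lemma integral_iterate_le (r tau T0 : R) : 0 <= r -> 0 <= tau -> r * T0 + tau <= T0 ->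
  0 <= T0 ->
  (forall (nu : probability (config R ('I_m * 'I_s)%type) R) (y : 'cV[R]_n),
     gaussian_law nu ->
     (\int[nu]_c (msq (bgk_step A b (mx_of c) y - xs))%:E <=
      (r * msq (y - xs) + tau)%:E)%E) ->
  forall k, (\int[mu]_c (msq (iterate c k - xs))%:E <=
             (r ^+ k * msq (x0 - xs) + T0)%:E)%E.
Proof.
move=> r0 tau0 rT T00 step.
have mI k : measurable_fun setT (fun c => (msq (iterate c k - xs))%:E).
  apply/measurable_EFinP; apply: measurable_msq; apply: measurable_mxB.
    exact: measurable_iterate.
  exact: measurable_mx_cst.
have mu1 : mu setT = 1%E by exact: probability_setT.
have cstE (a : R) : (\int[mu]_c a%:E = a%:E)%E.
  by rewrite integral_cst// [X in (_ * X)%E]mu1 mule1.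
elim=> [|k IH].
  have := cstE (msq (x0 - xs)); rewrite /iterate /= => ->.
  by rewrite lee_fin expr0 mul1r lerDl.
apply: (@le_trans _ _
    (\int[mu]_c (r%:E * (msq (iterate c k - xs))%:E + tau%:E))%E).
  apply: (le_integral_mix mu_gauss (U := fun p => p.1.1 == k)) => //.
  - by move=> c; rewrite lee_fin msq_ge0.
  - by apply: emeasurable_funD => //; exact: emeasurable_funM.
  - move=> c; set y := iterate c k.
    have mB : measurable_fun setT (fun c' : config R ('I_m * 'I_s)%type =>
        (msq (bgk_step A b (mx_of c') y - xs))%:E).
      apply/measurable_EFinP; apply: measurable_msq; apply: measurable_mxB.
        by apply: measurable_bgk_step; [exact: measurable_mx_of|exact: measurable_mx_cst].
      exact: measurable_mx_cst.
    rewrite (eq_integral (fun c' =>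
        (msq (bgk_step A b (mx_of (reindex (block k) c')) y - xs))%:E)).
      rewrite (ge0_integral_marginal (block k) mu mB) => [|c']; last first.
        by rewrite lee_fin msq_ge0.
      rewrite -EFinM -EFinD; apply: step; apply: marginal_gauss => //.
      exact: block_inj.
    move=> c' _; rewrite /iterate /= -/(iterate _ _) iterate_mix//.
    by rewrite sketch_of_mix sketch_ofE.
rewrite ge0_integralD//=; last 2 first.
- by move=> c _; rewrite -EFinM lee_fin mulr_ge0 ?msq_ge0.
- exact: emeasurable_funM.
rewrite cstE ge0_integralZl// => [|c _]; last by rewrite lee_fin msq_ge0.
apply: (@le_trans _ _ (r%:E * (r ^+ k * msq (x0 - xs) + T0)%:E + tau%:E)%E).
  by rewrite leeD2r// lee_wpmul2l// lee_fin.
by rewrite -EFinM -EFinD lee_fin mulrDr mulrA -exprS -addrA lerD2l.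
Qed.

End Iterates.

(** * Rates and the theorem *)

(** The product [(1 - q) ^+ s * (1 + s%:R * q)] decreases in [s]. *)
Lemma expr_onem_le (R : realFieldType) (q : R) s : 0 <= q <= 1 ->
  (1 - q) ^+ s <= (1 + s%:R * q)^-1.
Proof.
move=> /andP[q0 q1].
have pos k : 0 < 1 + k%:R * q by rewrite ltr_pwDl// mulr_ge0.
rewrite -[leRHS]mul1r ler_pdivlMr//.
elim: s => [|s IH]; first by rewrite expr0 mul0r addr0 mulr1.
apply: le_trans IH; rewrite exprSr -mulrA ler_wpM2l ?exprn_ge0 ?subr_ge0//.
rewrite -subr_ge0.
have -> : 1 + s%:R * q - (1 - q) * (1 + s.+1%:R * q) = s.+1%:R * q ^+ 2.
  by rewrite -natr1; ring.
by rewrite mulr_ge0 ?sqr_ge0.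
Qed.

(** By [expr_onem_le] the left side is at most [1 - x / (3 F^2 + x)], where
    [x = s sg^2], and [F^2 + x] is at most the square of the denominator on the
    right. The same argument gives the bound with 3 in the place of 80. *)
Lemma rate_le (R : rcfType) (s : nat) (sg N F : R) : 0 < sg -> sg <= N -> 0 < F ->
  sg ^+ 2 <= F ^+ 2 ->
  (1 - sg ^+ 2 / (3 * F ^+ 2)) ^+ s <=
  1 - 80%:R^-1 * (Num.sqrt s%:R * sg / (Num.sqrt s%:R * N + F)) ^+ 2.
Proof.
move=> sg0 sgN F0 sgF.
have N0 : 0 < N by exact: lt_le_trans sgN.
have F20 : 0 < F ^+ 2 by rewrite exprn_gt0.
have q01 : 0 <= sg ^+ 2 / (3 * F ^+ 2) <= 1.
  apply/andP; split; first by rewrite divr_ge0 ?sqr_ge0// mulr_ge0// ltW.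
  by rewrite ler_pdivrMr ?mulr_gt0// mul1r; lra.
apply: (le_trans (expr_onem_le s q01)).
have sE : Num.sqrt s%:R ^+ 2 = s%:R :> R by rewrite sqr_sqrtr.
have rs0 : 0 <= Num.sqrt s%:R :> R by exact: sqrtr_ge0.
have D0 : 0 < Num.sqrt s%:R * N + F by rewrite ltr_wpDl// mulr_ge0// ltW.
have D2 : s%:R * sg ^+ 2 + F ^+ 2 <= (Num.sqrt s%:R * N + F) ^+ 2.
  rewrite sqrrD exprMn sE lerD2r.
  apply: (@le_trans _ _ (s%:R * N ^+ 2)).
    by rewrite ler_wpM2l// lerXn2r ?nnegrE ?(ltW sg0) ?(ltW N0).
  by rewrite lerDl mulrn_wge0// !mulr_ge0 ?(ltW N0) ?(ltW F0).
rewrite exprMn exprVn exprMn sE.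
have sx0 : 0 <= s%:R * sg ^+ 2 by rewrite mulr_ge0 ?sqr_ge0.
have D20 : 0 < (Num.sqrt s%:R * N + F) ^+ 2 by rewrite exprn_gt0.
move: D2 sx0 F20 D20.
set x := s%:R * sg ^+ 2; set f := F ^+ 2; set D := (_ + _) ^+ 2 => D2 x0 f0 D0'.
have -> : (1 + s%:R * (sg ^+ 2 / (3 * f)))^-1 = 1 - x / (3 * f + x).
  rewrite /x; field; rewrite !gt_eqF// ?ltr_pwDl//; last by rewrite mulr_gt0.
rewrite lerD2l lerN2 mulrCA ler_wpM2l// -invfM lef_pV2 ?posrE ?mulr_gt0//.
  by lra.
by rewrite ltr_pwDl// mulr_gt0.
Qed.

(** As [sqrt n * sqrt s >= s], the squared gap is at most [n - s], which is at
    most [2 * (n - s - 1)]. *)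
Lemma sqrt_gap_le (R : rcfType) (n s : nat) : (s.+1 < n)%N ->
  (n%:R - s%:R - 1)^-1 <= 2 / (Num.sqrt n%:R - Num.sqrt s%:R) ^+ 2 :> R.
Proof.
move=> sn; set a := Num.sqrt n%:R; set c := Num.sqrt s%:R.
have aE : a ^+ 2 = n%:R by rewrite sqr_sqrtr.
have cE : c ^+ 2 = s%:R by rewrite sqr_sqrtr.
have ca : c < a by rewrite ltr_sqrt ?ltr0n ?ltr_nat ?(ltn_trans _ sn)// (leq_trans _ sn).
have c0 : 0 <= c by exact: sqrtr_ge0.
have sn2 : s%:R + 2 <= n%:R :> R by rewrite -natrD ler_nat addn2.
rewrite -aE -cE in sn2 *.
rewrite ler_pdivlMr ?exprn_gt0 ?subr_gt0// mulrC ler_pdivrMr; last by lra.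
by nra.
Qed.

Section OneStep.
Variables (R : realType) (m n s : nat) (A : 'M[R]_(m, n)) (b : 'cV[R]_m).
Variables (xs : 'cV[R]_n).
Local Notation config := (config R ('I_m * 'I_s)%type).
Variable mu : probability config R.
Hypothesis mu_gauss : gaussian_law mu.

Lemma integral_bgk_step_le (sg r tau : R) (y : 'cV[R]_n) :
  0 < msq A -> 0 <= sg -> sg <= msq A ->
  (forall z : 'cV[R]_n, sg * msq z <= msq (A *m z)) ->
  (1 - sg / (3 * msq A)) ^+ s <= r ->
  (\int[mu]_c (msq (moore_penrose (sketched A c) *m
                     ((mx_of c)^T *m (A *m xs - b))))%:E <= tau%:E)%E ->
  (\int[mu]_c (msq (bgk_step A b (mx_of c) y - xs))%:E <=
      (r * msq (y - xs) + tau)%:E)%E.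
Proof.
move=> A0 sg0 sgA sgP hr htau.
under eq_integral do rewrite msq_bgk_step EFinD.
have mS : measurable_mx (fun c : config => mx_of c) by exact: measurable_mx_of.
have mST : measurable_mx (fun c : config => (mx_of c)^T) by exact: measurable_mxT.
have mM : measurable_mx (fun c : config => (mx_of c)^T *m A).
  by apply: measurable_mxM => //; exact: measurable_mx_cst.
have mP : measurable_mx (fun c : config => moore_penrose ((mx_of c)^T *m A)).
  exact: measurable_moore_penrose.
rewrite ge0_integralD//=.
- rewrite EFinD; apply: leeD; last exact: htau.
  apply: (le_trans (integral_compl_row_proj_le mu_gauss (y - xs) A0 sg0 sgA sgP)).
  by rewrite lee_fin ler_wpM2r ?msq_ge0.
- by move=> c _; rewrite lee_fin msq_ge0.
- apply/measurable_EFinP; apply: measurable_msq; apply: measurable_mxM.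
    by apply: measurable_mxB; [exact: measurable_mx_cst|exact: measurable_mxM].
  exact: measurable_mx_cst.
- by move=> c _; rewrite lee_fin msq_ge0.
- apply/measurable_EFinP; apply: measurable_msq; apply: measurable_mxM => //.
  by apply: measurable_mxM => //; exact: measurable_mx_cst.
Qed.

End OneStep.

Section Law.
Variables (R : realType) (d : measure_display) (T : measurableType d).
Variables (P : probability T R) (m s : nat).
Variable g : nat * 'I_m * 'I_s -> {RV P >-> R}.

Lemma measurable_draws :
  measurable_fun setT (fun w => (fun t => g t w) : config R (nat * 'I_m * 'I_s)%type).
Proof. by apply: measurable_to_config => t; exact: (measurable_funP (g t)). Qed.

Definition draws_law : probability (config R (nat * 'I_m * 'I_s)%type) R :=
  distribution P (mfun_of measurable_draws).

Lemma draws_law_gauss : iid_standard_normal g -> gaussian_law draws_law.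
Proof.
move=> [indep std] J B uJ mB.
transitivity (P [set w | forall i, i \in J -> B i (g i w)]); first by [].
rewrite indep//; apply: eq_bigr => i _.
by rewrite -(std i (B i) (mB i)).
Qed.

End Law.

(* The hypothesis s.+1 < n \/ A *m xs = b removes only the case s = n - 1 with
   a nonzero residual, where the expectation is +oo for every k >= 1. *)
Theorem theorem2p7 (R : realType) :
  exists2 C : R, 0 < C &
  forall (alpha : R) (m n s : nat) (A : 'M[R]_(m, n)) (b : 'cV[R]_m)
         (xs x0 : 'cV[R]_n)
         (d : measure_display) (T : measurableType d) (P : probability T R)
         (g : nat * 'I_m * 'I_s -> {RV P >-> R}),
    alpha < 1 ->
    (n <= m)%N ->
    \rank A = n ->
    is_least_squares A b xs ->
    (0 < s)%N ->
    s%:R <= alpha * n%:R ->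
    (s.+1 < n)%N \/ A *m xs = b ->
    iid_standard_normal g ->
    forall k : nat,
      ('E_P[fun w => (norm2 (bgk A b x0 (sketch g w) k - xs) ^+ 2)%R]
       <= ((1 - 80%:R^-1 *
              (Num.sqrt s%:R * sigma_min A
               / (Num.sqrt s%:R * op_norm A + frobenius A)) ^+ 2) ^+ k
             * norm2 (x0 - xs) ^+ 2
           + C * (Num.sqrt s%:R * op_norm A + frobenius A) ^+ 2
               * norm2 (A *m xs - b) ^+ 2
             / (sigma_min A ^+ 4 * (Num.sqrt n%:R - Num.sqrt s%:R) ^+ 2))%:E)%E.
Proof.
(* 80 from the rate, times 2 from [sqrt_gap_le]. *)
exists 160%:R; first by rewrite ltr0n.
move=> alpha m n s A b xs x0 d T P g alpha1 nm rA ls s0 s_alpha sn_or iid k.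
have sn : (s < n)%N.
  have [n0|n0] := posnP n.
    by move: s_alpha; rewrite n0 mulr0 lern0 -leqn0 leqNgt s0.
  rewrite -(ltr_nat R) (le_lt_trans s_alpha)// -[ltRHS]mul1r ltr_pM2r//.
  by rewrite ltr0n.
have n0 : (0 < n)%N by exact: leq_ltn_trans sn.
pose e := A *m xs - b.
have Ae : A^T *m e = 0 by exact: least_squares_orthogonal.
have sg0 := sigma_min_gt0 n0 rA.
have sg20 : 0 < sigma_min A ^+ 2 by rewrite exprn_gt0.
have sgP := sigma_min_le A n0.
have FE := frobenius_sqr A.
have sgF : sigma_min A ^+ 2 <= msq A.
  have d1 : msq (delta_mx (Ordinal n0) 0 : 'cV[R]_n) = 1.
    rewrite msqE (bigD1 (Ordinal n0))//= big_ord1 mxE !eqxx expr1n big1 ?addr0// => i i0.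
    by rewrite big_ord1 mxE (negbTE i0) expr0n.
  have := le_trans (sgP (delta_mx (Ordinal n0) 0)) (msq_mulmx _ _).
  by rewrite d1 !mulr1.
have A0 : 0 < msq A by exact: lt_le_trans sgF.
have F0 : 0 < frobenius A.
  rewrite lt_neqAle sqrtr_ge0 andbT eq_sym; apply/eqP => F0.
  by move: A0; rewrite -FE F0 expr0n ltxx.
have sgN := sigma_min_op_norm A n0.
rewrite !norm2_sqr -/e.
set D := Num.sqrt s%:R * op_norm A + frobenius A.
have D0 : 0 < D.
  by rewrite ltr_wpDl// mulr_ge0 ?sqrtr_ge0// (le_trans _ sgN)// ltW.
set gap := (Num.sqrt n%:R - Num.sqrt s%:R) ^+ 2.
have gap0 : 0 < gap.
  by rewrite exprn_gt0// subr_gt0 ltr_sqrt ?ltr0n// ltr_nat.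
have hr := rate_le s sg0 sgN F0 (eq_ind_r (fun z => _ <= z) sgF FE).
rewrite FE -/D in hr; set r := 1 - 80%:R^-1 * _ in hr *.
have r0 : 0 <= r.
  apply: le_trans hr; rewrite exprn_ge0// subr_ge0 ler_pdivrMr ?mulr_gt0// mul1r.
  by lra.
(* For [e = 0] the denominator [n - s - 1] may vanish. *)
pose tau := if e == 0 then 0 else msq e * (s%:R / sigma_min A ^+ 2 / (n%:R - s%:R - 1)).
set T0 := _ * _ * _ / _.
have T00 : 0 <= T0.
  apply: divr_ge0; last exact: mulr_ge0 (exprn_ge0 _ (ltW sg0)) (ltW gap0).
  by rewrite mulr_ge0 ?msq_ge0// mulr_ge0 ?sqr_ge0.
have tau_le : tau <= (1 - r) * T0.
  have -> : (1 - r) * T0 = msq e * (s%:R / sigma_min A ^+ 2) * (2 / gap).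
    rewrite /r opprB addrC subrK /T0 exprMn exprVn exprMn sqr_sqrtr//.
    by field; rewrite !gt_eqF.
  rewrite /tau; case: eqP => [->|/eqP e0]; first by rewrite msq0 !mul0r.
  have sn1 : (s.+1 < n)%N.
    by case: sn_or => // Axb; move: e0; rewrite /e Axb subrr eqxx.
  rewrite mulrA ler_wpM2l ?sqrt_gap_le//.
  by rewrite mulr_ge0 ?msq_ge0// divr_ge0// ltW.
have tau0 : 0 <= tau.
  rewrite /tau; case: eqP => // /eqP e0.
  rewrite mulr_ge0 ?msq_ge0// divr_ge0// ?divr_ge0 ?(ltW sg20)//.
  by rewrite -addrA -opprD natr1 subr_ge0 ler_nat.
have rT : r * T0 + tau <= T0 by move: tau_le; rewrite mulrBl mul1r; lra.
have step (nu : probability (config R ('I_m * 'I_s)%type) R) (y : 'cV[R]_n) :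
     gaussian_law nu ->
     (\int[nu]_c (msq (bgk_step A b (mx_of c) y - xs))%:E <=
      (r * msq (y - xs) + tau)%:E)%E.
  move=> nu_gauss.
  apply: (integral_bgk_step_le nu_gauss y A0 (ltW sg20) sgF sgP hr).
  rewrite -/e /tau; case: eqP => [->|/eqP e0].
    under eq_integral do rewrite !mulmx0 msq0.
    by rewrite integral0.
  apply: (integral_pinv_residual_le rA sg20 sgP nu_gauss Ae).
  by case: sn_or => // Axb; move: e0; rewrite /e Axb subrr eqxx.
have := integral_iterate_le x0 (draws_law_gauss iid) r0 tau0 rT T00 step k.
apply: le_trans; rewrite unlock.
have mI : measurable_fun setT (fun c : config R (nat * 'I_m * 'I_s)%type =>
    (msq (iterate A b x0 c k - xs))%:E).
  apply/measurable_EFinP; apply: measurable_msq; apply: measurable_mxB.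
    exact: measurable_iterate.
  exact: measurable_mx_cst.
rewrite /draws_law.
rewrite (ge0_integral_distribution (mfun_of (measurable_draws g)) mI); last first.
  by move=> c; rewrite lee_fin msq_ge0.
by under eq_integral do rewrite norm2_sqr.
Qed.
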